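(* Let $U_{2t}(q)$ and $V_{2t}(q)$ be defined by $$U_{2t}(q)=\frac{\sum_{n\geq0}(-1)^n(2n+1)^{2t+1}q^{\frac{n(n+1)}2}}{\sum_{n\geq0}(-1)^n(2n+1)q^{\frac{n(n+1)}2}},\qquad V_{2t}(q)=\frac{\sum_{n=-\infty}^{\infty}(-1)^n(6n+1)^{2t}q^{\frac{n(3n+1)}2}}{\sum_{n=-\infty}^{\infty}(-1)^n q^{\frac{n(3n+1)}2}}.$$ For a partition $\lambda=(1^{m_1},2^{m_2},\dots,n^{m_n})\vdash n$ (where $m_k$ is the multiplicity of the part $k$), define $$\phi_U(\lambda):=4^{n}(2n+1)! \prod_{k=1}^n \frac{1}{m_k !}\left(\frac{B_{2k}}{(2k)\,(2k)!}\right)^{m_k},\qquad \phi_V(\lambda):=4^n(2n)! \prod_{k=1}^n \frac1{m_k!} \left(\frac{(4^k-1)B_{2k}}{(2k)\,(2k)!}\right)^{m_k},$$ and for a function $\phi$ on partitions let $\mathrm{Tr}_n(\phi;q):=\sum_{\lambda\vdash n}\phi(\lambda)E_\lambda(q)$, where $E_\lambda(q):=E_2(q)^{m_1}E_4(q)^{m_2}\cdots E_{2n}(q)^{m_n}$. Then for every positive integer $t$: (1) $U_{2t}(q)=\mathrm{Tr}_t(\phi_U;q)$; (2) $V_{2t}(q)=\mathrm{Tr}_t(\phi_V;q)$.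
   Context: $B_{2k}$ denotes the $2k$-th Bernoulli number. The Eisenstein series are $E_{2k}(q):=1-\frac{4k}{B_{2k}}\sum_{n=1}^{\infty}\sigma_{2k-1}(n)q^n$ with $\sigma_v(n)=\sum_{d\mid n}d^v$ (so $E_2=1-24\sum\sigma_1(n)q^n$, $E_4=1+240\sum\sigma_3(n)q^n$, etc.). A partition $\lambda\vdash n$ is a nonincreasing sequence of positive integers summing to $n$. *)

(* Defs.v *)
From HB Require Import structures.
From mathcomp Require Import all_boot all_order all_algebra.
From mathcomp Require Import zify ring.
From mathcomp Require Import boolp classical_sets functions cardinality fsbigop.

Set Implicit Arguments.
Unset Strict Implicit.
Unset Printing Implicit Defensive.

Import Order.TTheory GRing.Theory Num.Theory.

Local Open Scope classical_set_scope.
Local Open Scope ring_scope.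

(* [f n] is the coefficient of q^n in [f]. *)
Record fps (K : Type) := Fps { coefs :> nat -> K }.

HB.instance Definition _ (K : Type) := gen_eqMixin (fps K).
HB.instance Definition _ (K : Type) := gen_choiceMixin (fps K).

Lemma fpsP (K : Type) (f g : fps K) : f =1 g -> f = g.
Proof. by case: f g => [f] [g] /= /funext ->. Qed.

Section FpsRing.
Variable K : fieldType.
Implicit Types f g h : fps K.

Definition fps_zero : fps K := Fps (fun=> 0).
Definition fps_opp f : fps K := Fps (fun n => - f n).
Definition fps_add f g : fps K := Fps (fun n => f n + g n).

Lemma fps_addA : associative fps_add.
Proof. by move=> f g h; apply: fpsP => n; exact: addrA. Qed.
Lemma fps_addC : commutative fps_add.
Proof. by move=> f g; apply: fpsP => n; exact: addrC. Qed.
Lemma fps_add0 : left_id fps_zero fps_add.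
Proof. by move=> f; apply: fpsP => n; exact: add0r. Qed.
Lemma fps_addN : left_inverse fps_zero fps_opp fps_add.
Proof. by move=> f; apply: fpsP => n; exact: addNr. Qed.

HB.instance Definition _ :=
  GRing.isZmodule.Build (fps K) fps_addA fps_addC fps_add0 fps_addN.

Definition fps_one : fps K := Fps (fun n => (n == 0%N)%:R).
Definition fps_mul f g : fps K := Fps (fun n => \sum_(i < n.+1) f i * g (n - i)%N).

Definition fps_trunc N f : {poly K} := \poly_(i < N) f i.

Lemma coef_fps_mul N f g i : (i < N)%N ->
  fps_mul f g i = (fps_trunc N f * fps_trunc N g)`_i.
Proof.
move=> iN; rewrite coefM; apply: eq_bigr => j _; rewrite !coef_poly.
by rewrite (leq_ltn_trans (leq_ord j) iN) (leq_ltn_trans (leq_subr j i) iN).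
Qed.

Lemma fps_mulC : commutative fps_mul.
Proof.
by move=> f g; apply: fpsP => n; rewrite !(@coef_fps_mul n.+1) // mulrC.
Qed.

Lemma fps_mulA : associative fps_mul.
Proof.
move=> f g h; apply: fpsP => n.
transitivity (fps_trunc n.+1 f * fps_trunc n.+1 g * fps_trunc n.+1 h)`_n.
  rewrite -mulrA coefM; apply: eq_bigr => i _.
  by rewrite (@coef_fps_mul n.+1) ?coef_poly ?ltn_ord // ltnS leq_subr.
rewrite coefM; apply: eq_bigr => i _.
by rewrite (@coef_fps_mul n.+1) ?ltn_ord // [in LHS]coef_poly ltnS leq_subr.
Qed.

Lemma fps_mul1 : left_id fps_one fps_mul.
Proof.
move=> f; apply: fpsP => n /=.
rewrite big_ord_recl /= mul1r subn0 big1 ?addr0 // => i _.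
by rewrite mul0r.
Qed.

Lemma fps_mulDl : left_distributive fps_mul fps_add.
Proof.
move=> f g h; apply: fpsP => n /=; rewrite -big_split /=.
by apply: eq_bigr => i _; rewrite mulrDl.
Qed.

Lemma fps_one_neq0 : fps_one != fps_zero.
Proof.
apply/eqP => /(congr1 (fun f : fps K => f 0%N)) /= /eqP.
by rewrite (negPf (oner_neq0 K)).
Qed.

HB.instance Definition _ := GRing.Zmodule_isComNzRing.Build (fps K)
  fps_mulA fps_mulC fps_mul1 fps_mulDl fps_one_neq0.

Definition fps_scale (a : K) f : fps K := Fps (fun n => a * f n).

Lemma fps_scaleA a b f : fps_scale a (fps_scale b f) = fps_scale (a * b) f.
Proof. by apply: fpsP => n /=; rewrite mulrA. Qed.
Lemma fps_scale1 : left_id 1 fps_scale.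
Proof. by move=> f; apply: fpsP => n /=; rewrite mul1r. Qed.
Lemma fps_scaleDr : right_distributive fps_scale +%R.
Proof. by move=> a f g; apply: fpsP => n /=; rewrite mulrDr. Qed.
Lemma fps_scaleDl f : {morph fps_scale^~ f : a b / a + b}.
Proof. by move=> a b; apply: fpsP => n /=; rewrite mulrDl. Qed.

HB.instance Definition _ := GRing.Zmodule_isLmodule.Build K (fps K)
  fps_scaleA fps_scale1 fps_scaleDr fps_scaleDl.

Lemma fps_scaleAl (a : K) f g : a *: (f * g) = (a *: f) * g.
Proof.
apply: fpsP => n /=; rewrite mulr_sumr.
by apply: eq_bigr => i _; rewrite mulrA.
Qed.

HB.instance Definition _ := GRing.Lmodule_isLalgebra.Build K (fps K) fps_scaleAl.
HB.instance Definition _ := GRing.Lalgebra_isComAlgebra.Build K (fps K).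

(* The first [n] coefficients of the inverse g of [f], solved from f * g = 1. *)
Fixpoint fps_inv_seq f (n : nat) : seq K :=
  if n is m.+1 then
    let s := fps_inv_seq f m in
    rcons s ((f 0%N)^-1 * ((m == 0%N)%:R - \sum_(i < m) s`_i * f (m - i)%N))
  else [::].

Definition fps_unit : {pred fps K} := fun f => f 0%N != 0.
Definition fps_inv f : fps K :=
  if f \in fps_unit then Fps (fun n => (fps_inv_seq f n.+1)`_n) else f.

Lemma size_fps_inv_seq f n : size (fps_inv_seq f n) = n.
Proof. by elim: n => //= n IHn; rewrite size_rcons IHn. Qed.

Lemma nth_fps_inv_seq f n i : (i < n)%N ->
  (fps_inv_seq f n)`_i = (fps_inv_seq f i.+1)`_i.
Proof.
elim: n => // n IHn; rewrite ltnS leq_eqVlt => /predU1P[-> // | lt_in].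
by rewrite [in LHS]/= nth_rcons size_fps_inv_seq lt_in IHn.
Qed.

Lemma fps_mulV : {in fps_unit, left_inverse 1 fps_inv *%R}.
Proof.
move=> f uf; apply: fpsP => n; rewrite /fps_inv uf /=.
rewrite big_ord_recr /= subnn nth_rcons size_fps_inv_seq ltnn eqxx.
rewrite mulrC mulrA divff // mul1r addrC.
under [X in _ + X]eq_bigr => i _ do
  rewrite -[rcons _ _]/(fps_inv_seq f i.+1) -(nth_fps_inv_seq f (ltn_ord i)).
by rewrite subrK.
Qed.

Lemma fps_unitPl f g : g * f = 1 -> fps_unit f.
Proof.
move=> /(congr1 (fun h : fps K => h 0%N)) /=.
rewrite big_ord1 => gf1; apply/eqP => f0; move: gf1; rewrite f0 mulr0 => /eqP.
by rewrite eq_sym (negPf (oner_neq0 K)).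
Qed.

Lemma fps_inv_out : {in [predC fps_unit], fps_inv =1 id}.
Proof. by move=> f; rewrite inE /fps_inv => /negPf ->. Qed.

HB.instance Definition _ := GRing.ComNzRing_hasMulInverse.Build (fps K)
  fps_mulV fps_unitPl fps_inv_out.

Lemma fps_unitE f : (f \is a GRing.unit) = (f 0%N != 0).
Proof. by []. Qed.

(* The formal sum  \sum_(i : I) c_i q^(e_i); it is meaningful when every
   exponent is attained by finitely many indices (the coefficient at an
   exponent attained infinitely often with c_i <> 0 would be 0 by convention). *)
Definition qseries (I : choiceType) (c : I -> K) (e : I -> nat) : fps K :=
  Fps (fun m => \sum_(i \in [set i | e i = m]) c i).

End FpsRing.

(* B_n = n! [x^n] x / (e^x - 1), where (e^x - 1) / x = \sum_k x^k / (k+1)!. *)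
Definition bernoulli (n : nat) : rat :=
  n`!%:R * (Fps (fun k : nat => (k.+1)`!%:R^-1 : rat))^-1 n.

Definition sigma (v n : nat) : nat := \sum_(d <- divisors n) d ^ v.

(* The index is half the weight: [eisenstein k] is E_{2k}. *)
Definition eisenstein (k : nat) : fps rat :=
  Fps (fun n => if n is 0%N then 1
                else - ((4 * k)%:R / bernoulli (2 * k)) * (sigma (2 * k - 1) n)%:R).

Definition is_partition (n : nat) (l : seq nat) : bool :=
  [&& sorted geq l, all (leq 1) l & sumn l == n].

Definition mult (k : nat) (l : seq nat) : nat := count_mem k l.

Lemma finite_partitions (n : nat) : finite_set [set l | is_partition n l].
Proof.
apply: (@sub_finite_set _ _
  [set map (@nat_of_ord n.+1) (bseqval s) | s in [set: n.-bseq 'I_n.+1]]);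
  last exact: finite_image.
move=> l /= /and3P[_ l_gt0 /eqP <-] {n}.
have size_l : (size l <= sumn l)%N.
  elim: l l_gt0 => //= k l IHl /andP[k_gt0 /IHl]; lia.
have le_l : all (fun k => k < (sumn l).+1)%N l.
  elim: l {l_gt0 size_l} => //= k l IHl; rewrite ltnS leq_addr /=.
  by apply: sub_all IHl => i; lia.
have size_s : (size (map (@inord (sumn l)) l) <= sumn l)%N by rewrite size_map.
exists (Bseq size_s) => //=; rewrite -map_comp.
rewrite -[RHS]map_id; apply/eq_in_map => k /(allP le_l) ltk /=.
by rewrite inordK.
Qed.

Definition phiU (l : seq nat) : rat :=
  let n := sumn l in
  4%:R ^+ n * ((2 * n).+1)`!%:R *
  \prod_(1 <= k < n.+1)
     ((mult k l)`!%:R^-1 *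
      (bernoulli (2 * k) / ((2 * k)%:R * (2 * k)`!%:R)) ^+ mult k l).

Definition phiV (l : seq nat) : rat :=
  let n := sumn l in
  4%:R ^+ n * (2 * n)`!%:R *
  \prod_(1 <= k < n.+1)
     ((mult k l)`!%:R^-1 *
      ((4%:R ^+ k - 1) * bernoulli (2 * k) / ((2 * k)%:R * (2 * k)`!%:R))
        ^+ mult k l).

Definition eisenstein_part (l : seq nat) : fps rat :=
  \prod_(1 <= k < (sumn l).+1) eisenstein k ^+ mult k l.

Definition Tr (n : nat) (phi : seq nat -> rat) : fps rat :=
  \sum_(l \in [set l | is_partition n l]) phi l *: eisenstein_part l.

Definition thetaU (s : nat) : fps rat :=
  qseries (fun n : nat => (-1) ^+ n * (2 * n + 1)%:R ^+ s)
          (fun n : nat => (n * (n + 1)) %/ 2)%N.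

(* The exponent n(3n+1)/2 is a nonnegative integer for every n in Z, so the
   absolute value only casts it to nat; see [thetaV_exponent]. *)
Definition thetaV (s : nat) : fps rat :=
  qseries (fun n : int => (-1) ^ n * (6 * n + 1)%:~R ^+ s)
          (fun n : int => `|((n * (3 * n + 1)) %/ 2)%Z|%N).

Definition Useries (s : nat) : fps rat := thetaU s.+1 / thetaU 1.
Definition Vseries (s : nat) : fps rat := thetaV s / thetaV 0.

Lemma finite_thetaU_fiber (m : nat) :
  finite_set [set n : nat | (n * (n + 1)) %/ 2 = m]%N.
Proof.
apply: (@sub_finite_set _ _ [set` iota 0 (m + 1)%N]);
  last exact: finite_seq.
by move=> n /= <-; rewrite mem_iota; nia.
Qed.

Lemma thetaV_exponent (n : int) :
  `|((n * (3 * n + 1)) %/ 2)%Z|%N%:Z * 2 = n * (3 * n + 1).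
Proof.
have [x eqx] : exists x : int, n * (3 * n + 1) = x * 2.
  have [k [->|->]] : exists k, n = 2 * k \/ n = 2 * k + 1.
    by exists (n %/ 2)%Z; lia.
  - by exists (k * (6 * k + 1)); ring.
  by exists ((2 * k + 1) * (3 * k + 2)); ring.
rewrite eqx mulzK //; have : 0 <= x by nia.
by lia.
Qed.

Lemma finite_thetaV_fiber (m : nat) :
  finite_set [set n : int | `|((n * (3 * n + 1)) %/ 2)%Z|%N = m].
Proof.
apply: (@sub_finite_set _ _
  [set` [seq k%:Z - m%:Z | k <- iota 0 (2 * m + 1)%N]]); last exact: finite_seq.
move=> /= n nm; have := thetaV_exponent n; rewrite nm => eqn.
apply/mapP; exists (absz (n + m%:Z)); first by rewrite mem_iota; nia.
by nia.
Qed.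

Lemma thetaU_unit : thetaU 1 \is a GRing.unit.
Proof.
rewrite fps_unitE /=.
have -> : [set n : nat | (n * (n + 1)) %/ 2 = 0]%N = [set 0%N].
  by apply/seteqP; split => n /=; [nia | move=> ->].
by rewrite fsbig_set1 expr0 mul1r expr1.
Qed.

Lemma thetaV_unit : thetaV 0 \is a GRing.unit.
Proof.
rewrite fps_unitE /=.
have -> : [set n : int | `|((n * (3 * n + 1)) %/ 2)%Z|%N = 0%N] = [set 0 : int].
  apply/seteqP; split => n /= => [n0|-> //].
  by have := thetaV_exponent n; rewrite n0; nia.
by rewrite fsbig_set1 expr0 mulr1 expr0z.
Qed.

(* Main.v *)
Require Import Defs.
From mathcomp Require Import all_boot all_order all_algebra.
From mathcomp Require Import zify ring lra.
From mathcomp Require Import boolp classical_sets functions cardinality fsbigop.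

(* Put T(x) = \sum_(k in Z) (-1)^k q^(k(k+1)/2) e^((2k+1)x), an odd series in x
   whose odd moments are twice the series [thetaU].  Its logarithmic derivative
   in x is
     T'/T = coth x - 2 \sum_(n,m >= 1) q^(nm) (e^(2mx) - e^(-2mx)),
   and x coth x - 4x \sum q^(nm) sinh(2mx) = 1 + \sum_k 4^k B_2k/(2k)! E_2k x^2k
   (this needs B_2k <> 0, which follows from the Riccati equation of coth).  So
   the normalised moments of T satisfy the recursion that characterises
   exp(\sum_k 4^k B_2k/(2k (2k)!) E_2k x^2k), whose coefficients are the sums over
   partitions.  The
   formula for T'/T is proved without the triple product: in
   T(x) \sum q^(nm) (e^(2mx) - e^(-2mx)) almost all terms with a given e^((2r+1)x)
   cancel under an explicit sign-reversing involution, and the surviving terms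
   match the expansion of T coth.
   For V, an explicit bijection of Z^2 preserving the quadratic form
   3(2m+1)^2 + (6n+1)^2 gives a quintuple product identity, namely that
   \sum_n (-1)^n q^(n(3n+1)/2) 2cosh((6n+1)x) times T(x) is a power series in q
   times T(2x).  Hence the logarithmic derivative for V is that of T(2x) minus
   that of T(x), which is where the factors 4^k - 1 come from. *)

Set Implicit Arguments.
Unset Strict Implicit.
Unset Printing Implicit Defensive.

Import Order.TTheory GRing.Theory Num.Theory.

Local Open Scope classical_set_scope.
Local Open Scope ring_scope.

(** * Formal sums of powers of q *)

(** The maps only have to be mutually inverse between the supports, so the explicit index maps used
    below may take any value where a coefficient vanishes. *)
Lemma fsum_reindex (V : nmodType) (I J : choiceType) (A : set I) (B : set J)
    (F : I -> V) (G : J -> V) (h : I -> J) (g : J -> I) :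
  (forall i, A i -> F i != 0 -> [/\ B (h i), g (h i) = i & G (h i) = F i]) ->
  (forall j, B j -> G j != 0 -> [/\ A (g j), h (g j) = j & F (g j) = G j]) ->
  \sum_(i \in A) F i = \sum_(j \in B) G j.
Proof.
move=> hP gP; rewrite [LHS]fsbig_supp [RHS]fsbig_supp.
rewrite (@reindex_fsbig _ _ _ _ _ h (A `&` F @^-1` [set~ 0]) (B `&` G @^-1` [set~ 0])).
  apply: eq_fsbigr => i; rewrite inE /= => -[Ai /eqP Fi].
  by have [_ _ ->] := hP i Ai Fi.
split=> [i [Ai /eqP Fi]|i j|j [Bj /eqP Gj]].
- by have [Bh _ Gh] := hP i Ai Fi; split=> //=; rewrite Gh; apply/eqP.
- rewrite !inE /= => -[Ai /eqP Fi] [Aj /eqP Fj] hij.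
  by have [_ <- _] := hP i Ai Fi; have [_ <- _] := hP j Aj Fj; rewrite hij.
- have [Ag hg Fg] := gP j Bj Gj; exists (g j) => //; split=> //=.
  by rewrite Fg; apply/eqP.
Qed.

(** Guards against the convention that a sum with infinite support is 0: sums and products of
    [qseries] are computed under this condition. *)
Definition finite_fibers (I : Type) (e : I -> nat) :=
  forall m, finite_set [set i | e i = m].

Section QSeries.
Variable K : fieldType.

Lemma coef_qseries (I : choiceType) (c : I -> K) (e : I -> nat) (s : seq I) (m : nat) :
  uniq s -> (forall i, e i = m -> c i != 0 -> i \in s) ->
  qseries c e m = \sum_(i <- s | e i == m) c i.
Proof.
move=> us sP; rewrite bigfs //; last first.
  by move=> i /eqP ei; apply: contraNeq => /sP; apply.
by apply: eq_fsbigl; apply/seteqP; split=> i /= /eqP.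
Qed.

Lemma fiber_enum (I : choiceType) (e : I -> nat) (M : nat) : finite_fibers e ->
  exists2 s : seq I, uniq s & forall i, (e i < M)%N -> i \in s.
Proof.
move=> fe; elim: M => [|M [s us sP]]; first by exists [::].
have /finite_seqP [s' Es'] := fe M.
exists (undup (s ++ s')); first exact: undup_uniq.
move=> i; rewrite mem_undup mem_cat ltnS leq_eqVlt => /orP[/eqP eM|/sP ->//].
have : [set` s'] i by rewrite -Es'.
by move=> /= ->; rewrite orbT.
Qed.

Lemma qseries_reindex (I J : choiceType) (c : I -> K) (e : I -> nat)
    (c' : J -> K) (e' : J -> nat) (h : I -> J) (g : J -> I) :
  (forall i, c i != 0 -> [/\ g (h i) = i, c' (h i) = c i & e' (h i) = e i]) ->
  (forall j, c' j != 0 -> [/\ h (g j) = j, c (g j) = c' j & e (g j) = e' j]) ->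
  qseries c e = qseries c' e'.
Proof.
move=> hP gP; apply: fpsP => m /=.
apply: (@fsum_reindex _ _ _ _ _ _ _ h g) => [i /= ei /hP|j /= ej /gP].
  by case=> -> -> ->.
by case=> -> -> ->.
Qed.

Lemma eq_qseries (I : choiceType) (c c' : I -> K) (e e' : I -> nat) :
  c =1 c' -> e =1 e' -> qseries c e = qseries c' e'.
Proof. by move=> /funext -> /funext ->. Qed.

Lemma qseries_sum (I : choiceType) (e : I -> nat) (n : nat)
    (a : 'I_n -> K) (c : 'I_n -> I -> K) : finite_fibers e ->
  qseries (fun x => \sum_(i < n) a i * c i x) e = \sum_(i < n) a i *: qseries (c i) e.
Proof.
move=> fe; apply: fpsP => m.
have [s us sP] := fiber_enum m.+1 fe.
have sP' x : e x = m -> x \in s by move=> ex; apply: sP; rewrite ex.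
rewrite (coef_qseries (s := s)) //; last by move=> x ex _; exact: sP'.
rewrite exchange_big /=.
have -> : forall (F : 'I_n -> fps K), (\sum_(i < n) F i) m = \sum_(i < n) F i m.
  by move=> F; elim/big_ind2: _ => //= x y z w <- <-.
apply: eq_bigr => i _; rewrite -mulr_sumr -[RHS]/(a i * qseries (c i) e m).
by rewrite (coef_qseries (s := s)) // => x ex _; exact: sP'.
Qed.

Lemma qseriesD (I : choiceType) (c c' : I -> K) (e : I -> nat) : finite_fibers e ->
  qseries (fun i => c i + c' i) e = qseries c e + qseries c' e.
Proof.
move=> fe.
have := qseries_sum (fun=> 1) (fun i : 'I_2 => if i == 0 then c else c') fe.
rewrite !big_ord_recl big_ord0 /= !scale1r addr0 => <-.
by apply: eq_qseries => // x; rewrite !big_ord_recl big_ord0 /= !mul1r addr0.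
Qed.

Lemma qseriesZ (I : choiceType) (a : K) (c : I -> K) (e : I -> nat) :
  qseries (fun i => a * c i) e = a *: qseries c e.
Proof. by apply: fpsP => m /=; rewrite mulr_fsumr. Qed.

Lemma qseriesN (I : choiceType) (c : I -> K) (e : I -> nat) :
  qseries (fun i => - c i) e = - qseries c e.
Proof.
by rewrite -scaleN1r -qseriesZ; apply: eq_qseries => // i; rewrite mulN1r.
Qed.

Lemma finite_fibersM (I J : Type) (e : I -> nat) (e' : J -> nat) :
  finite_fibers e -> finite_fibers e' ->
  finite_fibers (fun x : I * J => (e x.1 + e' x.2)%N).
Proof.
move=> fe fe' m.
apply: (@sub_finite_set _ _ (\bigcup_(k in `I_m.+1)
   ([set i | e i = k] `*` [set j | e' j = (m - k)%N]))).
  move=> [i j] /= <-; exists (e i); first by rewrite /= ltnS leq_addr.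
  by split=> //=; rewrite addKn.
by apply: bigcup_finite => // k _; apply: finite_setX.
Qed.

Lemma qseriesM (I J : choiceType) (c : I -> K) (e : I -> nat)
    (c' : J -> K) (e' : J -> nat) :
  finite_fibers e -> finite_fibers e' ->
  qseries c e * qseries c' e' =
  qseries (fun x : I * J => c x.1 * c' x.2) (fun x => (e x.1 + e' x.2)%N).
Proof.
move=> fe fe'; apply: fpsP => m.
have [s us sP] := fiber_enum m.+1 fe.
have [s' us' sP'] := fiber_enum m.+1 fe'.
have -> : (qseries c e * qseries c' e') m
    = \sum_(i < m.+1) qseries c e i * qseries c' e' (m - i)%N by [].
rewrite (coef_qseries (s := [seq (i, j) | i <- s, j <- s'])); first last.
- move=> [i j] /= eij _; apply/allpairsP; exists (i, j) => /=.
  by split=> //; [apply: sP|apply: sP']; lia.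
- by apply: allpairs_uniq => // -[x y] [z w].
rewrite [RHS]big_mkcond big_allpairs.
under [LHS]eq_bigr => k _.
  rewrite (coef_qseries (s := s)) // => [|i ei _]; last by apply: sP; rewrite ei.
  rewrite (coef_qseries (s := s')) // => [|i ei _]; last first.
    by apply: sP'; rewrite ei ltnS leq_subr.
  rewrite big_mkcond mulr_suml; over.
rewrite exchange_big /=; apply: eq_bigr => i _.
case: (ltnP (e i) m.+1) => [lt_em|le_me]; last first.
  rewrite big1 ?big1 // => [j _|k _]; first by case: eqP => //; lia.
  by case: eqP => [ek|_]; [have := ltn_ord k; lia | rewrite mul0r].
rewrite (bigD1 (Ordinal lt_em)) //= eqxx.
rewrite [X in _ + X]big1 ?addr0 => [|k]; last first.
  by case: (e i =P k) => [ek|]; [rewrite -val_eqE /= ek eqxx | rewrite mul0r].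
rewrite mulr_sumr [LHS]big_mkcond; apply: eq_bigr => j _ /=.
by have -> : (e' j == (m - e i)%N) = ((e i + e' j)%N == m) by apply/eqP/eqP; lia.
Qed.

(** Multiplying two generating functions in x adds the exponents [a] and [b]; the binomial theorem
    then expands the moments of the product. *)
Lemma qseries_moment (I J : choiceType) (s : I -> K) (a : I -> K) (e : I -> nat)
    (s' : J -> K) (b : J -> K) (e' : J -> nat) (n : nat) :
  finite_fibers e -> finite_fibers e' ->
  qseries (fun x : I * J => s x.1 * s' x.2 * (a x.1 + b x.2) ^+ n)
          (fun x => (e x.1 + e' x.2)%N) =
  \sum_(i < n.+1) 'C(n, i)%:R *:
    (qseries (fun x => s x * a x ^+ (n - i)) e * qseries (fun y => s' y * b y ^+ i) e').
Proof.
move=> fe fe'.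
under [RHS]eq_bigr do rewrite qseriesM //.
rewrite -qseries_sum; last exact: finite_fibersM.
apply: eq_qseries => // -[x y] /=.
rewrite exprDn mulr_sumr; apply: eq_bigr => i _.
by rewrite -mulr_natl; ring.
Qed.

End QSeries.

(** Reindexing by [h] makes the series equal to its own negative, and 2 is invertible in [rat]. *)
Lemma qseries_involution (I : choiceType) (c : I -> rat) (e : I -> nat) (h : I -> I) :
  (forall i, c i != 0 -> [/\ h (h i) = i, c (h i) = - c i & e (h i) = e i]) ->
  qseries c e = 0.
Proof.
move=> hP.
have /eqP : qseries c e = - qseries c e.
  rewrite -qseriesN; apply: (@qseries_reindex _ _ _ _ _ _ _ h h) => i.
    by move=> /hP[-> -> ->]; rewrite opprK.
  by rewrite oppr_eq0 => /hP[-> -> ->].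
rewrite -addr_eq0 -mulr2n -scaler_nat => /eqP q0.
by rewrite -[LHS](scalerK (a := 2%:R : rat)) // q0 scaler0.
Qed.

(** * Sums over partitions *)

Section PartitionSum.
Variable a : nat -> fps rat.

Definition part_weight (l : seq nat) : fps rat :=
  \prod_(1 <= k < (sumn l).+1) ((mult k l)`!%:R^-1 *: a k ^+ mult k l).

(** The coefficient of x^n in exp(\sum_(k >= 1) a_k x^k). *)
Definition part_sum (n : nat) : fps rat :=
  \sum_(l \in [set l | is_partition n l]) part_weight l.

Lemma leq_sumn_mem (k : nat) (l : seq nat) : k \in l -> (k <= sumn l)%N.
Proof.
elim: l => //= x l IHl; rewrite inE => /orP[/eqP ->|/IHl]; first exact: leq_addr.
by move=> kl; apply: leq_trans kl (leq_addl _ _).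
Qed.

Lemma part_weight_widen (N : nat) (l : seq nat) : (sumn l <= N)%N ->
  part_weight l = \prod_(1 <= k < N.+1) ((mult k l)`!%:R^-1 *: a k ^+ mult k l).
Proof.
move=> lN; rewrite [RHS](big_cat_nat (n := (sumn l).+1)) //=.
rewrite [X in _ = _ * X]big1_seq ?mulr1 // => k; rewrite mem_index_iota => /andP[_ /andP[lk _]].
suff -> : mult k l = 0%N by rewrite fact0 invr1 scale1r expr0.
apply/eqP; rewrite -leqn0 leqNgt -has_count has_pred1; apply/negP => /leq_sumn_mem.
by rewrite leqNgt lk.
Qed.

(** Adding a part k raises its multiplicity to some m, and m / m! = 1 / (m - 1)!. *)
Lemma part_weight_cons (k : nat) (l m : seq nat) : (0 < k)%N ->
  perm_eq l (k :: m) -> (mult k l)%:R *: part_weight l = a k * part_weight m.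
Proof.
move=> k_gt0 lm.
have El j : mult j l = ((k == j) + mult j m)%N by rewrite /mult (permP lm).
have sl : (sumn l = k + sumn m)%N by rewrite (perm_sumn lm).
have kN : k \in index_iota 1 (sumn l).+1 by rewrite mem_index_iota k_gt0 /=; lia.
rewrite (part_weight_widen (N := sumn l)) // (@part_weight_widen (sumn l) m); last by lia.
rewrite !(bigD1_seq k) ?iota_uniq //= scalerAl mulrA; congr (_ * _); last first.
  by apply: eq_bigr => j /negPf jk; rewrite El eq_sym jk.
rewrite El eqxx add1n factS exprS natrM invfM -scalerAr scalerA.
by rewrite mulrA divff ?mul1r // pnatr_eq0.
Qed.

Lemma sumn_mult (l : seq nat) : sumn l = (\sum_(k < sumn l) k.+1 * mult k.+1 l)%N.
Proof.
rewrite -(big_mkord xpredT (fun k => k.+1 * mult k.+1 l))%N.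
(* The bound is freed from [sumn l], which changes along the induction on the list. *)
suff H N : all (fun k => (k <= N)%N) l ->
   sumn l = (\sum_(0 <= k < N) k.+1 * mult k.+1 l)%N.
  by apply: H; apply/allP => k /leq_sumn_mem.
elim: l N => [|x l IHl] N /=; first by rewrite big1 // => k _; rewrite muln0.
case/andP => xN /IHl ->.
under [RHS]eq_bigr do rewrite /mult /= mulnDr.
rewrite [RHS]big_split; congr (_ + _)%N.
case: x xN => [|x] xN.
  by rewrite big1 // => k _; rewrite /= muln0.
rewrite (bigD1_seq x) ?iota_uniq ?mem_index_iota //= eqxx muln1 big1 ?addn0 //.
by move=> j /negPf jx; rewrite eqSS eq_sym jx muln0.
Qed.

(** Removing one part k is a bijection from the partitions of n that contain k to those of n - k; a
    partition without the part k has factor 0 on the left. *)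
Lemma part_sum_mult (n k : nat) : (0 < k <= n)%N ->
  \sum_(l \in [set l | is_partition n l]) (mult k l)%:R *: part_weight l
  = a k * part_sum (n - k).
Proof.
case/andP=> k_gt0 kn.
have geq_tr : transitive geq by move=> x y z /= xy /leq_trans; apply.
have geq_anti : antisymmetric geq by move=> x y /anti_leq.
have -> : a k * part_sum (n - k)
  = \sum_(m \in [set m | is_partition (n - k) m]) a k * part_weight m.
  rewrite /part_sum (fsbig_finite _ _ (finite_partitions _)) mulr_sumr.
  by rewrite (fsbig_finite _ _ (finite_partitions _)).
apply: (@fsum_reindex _ _ _ _ _ _ _ (rem k) (fun m => sort geq (k :: m))) => [l|m] /=.
  case/and3P=> sl pl /eqP nl Fl.
  have kl : k \in l.
    rewrite -has_pred1 has_count lt0n -/(mult k l).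
    by apply: contra Fl => /eqP ->; rewrite scale0r.
  have lp := perm_to_rem kl.
  split.
  - apply/and3P; split.
    + exact: subseq_sorted (rem_subseq _ _) sl.
    + by apply/allP => x /mem_rem /(allP pl).
    + by rewrite -nl (perm_sumn lp) /= addKn.
  - apply: (sorted_eq geq_tr geq_anti) => //; first exact: sort_sorted (fun x y => leq_total y x) _.
    by rewrite perm_sort perm_sym.
  - by rewrite (part_weight_cons k_gt0 lp).
case/and3P=> sm pm /eqP nm _.
have lp : perm_eq (sort geq (k :: m)) (k :: m) by rewrite perm_sort.
have kl : k \in sort geq (k :: m) by rewrite mem_sort mem_head.
split.
- apply/and3P; split.
  + exact: sort_sorted (fun x y => leq_total y x) _.
  + by rewrite (perm_all _ lp) /= k_gt0.
  + by rewrite (perm_sumn lp) /= nm subnKC.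
- apply: (sorted_eq geq_tr geq_anti) => //.
    apply: subseq_sorted (rem_subseq _ _) _ => //.
    exact: sort_sorted (fun x y => leq_total y x) _.
  by rewrite -(perm_cons k) -(permPl (perm_to_rem kl)).
- exact: part_weight_cons.
Qed.

(** The coefficient form of x (exp A)' = x A' exp A. Combinatorially, n is written as the sum of k
    m_k inside each partition and the two sums are exchanged. *)
Lemma part_sum_rec (n : nat) :
  n%:R *: part_sum n = \sum_(k < n) k.+1%:R *: (a k.+1 * part_sum (n - k.+1)).
Proof.
have fP := finite_partitions n.
rewrite (eq_bigr (fun k : 'I_n => k.+1%:R *:
   \sum_(l \in [set l | is_partition n l]) (mult k.+1 l)%:R *: part_weight l)); last first.
  by move=> k _; rewrite part_sum_mult ?ltn_ord.
under eq_bigr do rewrite (fsbig_finite _ _ fP) scaler_sumr.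
rewrite exchange_big /= /part_sum (fsbig_finite _ _ fP) scaler_sumr.
apply: eq_big_seq => l; rewrite in_fset_set // inE /= => /and3P[_ _ /eqP nl].
rewrite -{1}nl sumn_mult nl natr_sum scaler_suml.
by apply: eq_bigr => k _; rewrite natrM scalerA.
Qed.

Lemma part_sum0 : part_sum 0 = 1.
Proof.
rewrite /part_sum (_ : [set l | is_partition 0 l] = [set [::]]).
  by rewrite fsbig_set1 /part_weight big_nil.
apply/seteqP; split=> [l|l ->] //=.
by case: l => // x l /and3P[_ /=]; lia.
Qed.

End PartitionSum.

(** * Bernoulli numbers *)

Lemma sum_pairs (V : nmodType) (F : nat -> V) (n : nat) :
  \sum_(i < (2 * n)%N) F i = \sum_(i < n) (F (2 * i)%N + F (2 * i).+1).
Proof.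
elim: n => [|n IHn]; first by rewrite !big_ord0.
by rewrite mulnS !big_ord_recr /= IHn addrA.
Qed.

Lemma coef_fpsM (K : fieldType) (f g : fps K) (n : nat) :
  (f * g) n = \sum_(i < n.+1) f i * g (n - i)%N.
Proof. by []. Qed.

Lemma coef_fps_sum (K : fieldType) (I : Type) (s : seq I) (P : pred I)
    (F : I -> fps K) (n : nat) :
  (\sum_(i <- s | P i) F i) n = \sum_(i <- s | P i) F i n.
Proof. by elim/big_ind2: _ => //= x y z w <- <-. Qed.

(** The derivation x d/dx. *)
Definition euler_op (f : fps rat) : fps rat := Fps (fun n => n%:R * f n).

Lemma euler_opM (f g : fps rat) : euler_op (f * g) = euler_op f * g + f * euler_op g.
Proof.
apply: fpsP => n /=; rewrite mulr_sumr -big_split /=; apply: eq_bigr => i _.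
have -> : n%:R = i%:R + (n - i)%:R :> rat by rewrite -natrD subnKC // -ltnS.
by ring.
Qed.

Definition fps_var : fps rat := Fps (fun n => (n == 1%N)%:R).

Lemma coef_fps_varM (f : fps rat) (n : nat) :
  (fps_var * f) n = if n is m.+1 then f m else 0.
Proof.
case: n => [|n]; rewrite coef_fpsM big_ord_recl /= mul0r add0r ?big_ord0 //.
rewrite big_ord_recl big1 ?addr0 /= ?mul1r ?subn1 // => i _.
by rewrite mul0r.
Qed.

Definition fps_exp (c : rat) : fps rat := Fps (fun n => c ^+ n / n`!%:R).

Lemma natr_fact_neq0 (n : nat) : n`!%:R != 0 :> rat.
Proof. by rewrite pnatr_eq0 -lt0n fact_gt0. Qed.

Lemma invf_factM (n i : nat) : (i <= n)%N ->
  'C(n, i)%:R / n`!%:R = (i`!%:R)^-1 * ((n - i)`!%:R)^-1 :> rat.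
Proof.
move=> le_in; rewrite -(bin_fact le_in) !natrM.
have bn0 : 'C(n, i)%:R != 0 :> rat by rewrite pnatr_eq0 -lt0n bin_gt0.
by field; rewrite bn0 !natr_fact_neq0.
Qed.

Lemma fps_expD (a b : rat) : fps_exp (a + b) = fps_exp a * fps_exp b.
Proof.
apply: fpsP => n /=; rewrite addrC exprDn mulr_suml; apply: eq_bigr => i _.
rewrite -mulr_natr -(mulrA _ _ (_^-1)) invf_factM; last by rewrite -ltnS.
by ring.
Qed.

(* [locked] prevents [simpl] from unfolding the recursion defining the inverse. *)
Definition bernoulli_gf : fps rat :=
  locked ((Fps (fun k : nat => (k.+1)`!%:R^-1 : rat))^-1).

Lemma bernoulli_gfE (n : nat) : bernoulli n = n`!%:R * bernoulli_gf n.
Proof. by rewrite /bernoulli_gf -lock. Qed.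

Lemma bernoulli_gfVM : Fps (fun k : nat => (k.+1)`!%:R^-1 : rat) * bernoulli_gf = 1.
Proof. by rewrite /bernoulli_gf -lock; apply: mulrV; rewrite fps_unitE. Qed.

Lemma bernoulli_gf_exp : bernoulli_gf * (fps_exp 1 - 1) = fps_var.
Proof.
have -> : fps_exp 1 - 1 = fps_var * Fps (fun k : nat => (k.+1)`!%:R^-1 : rat).
  apply: fpsP => n; rewrite coef_fps_varM.
  by case: n => [|n] /=; rewrite ?expr0 ?expr1n ?divr1 ?subrr // mul1r subr0.
by rewrite mulrCA [bernoulli_gf * _]mulrC bernoulli_gfVM mulr1.
Qed.

(** With E = (e^x - 1)/x one has x E' = 1 + x E - E; differentiating E B = 1 and multiplying by B
    gives the equation. *)
Lemma euler_op_bernoulli :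
  euler_op bernoulli_gf = bernoulli_gf - fps_var * bernoulli_gf - bernoulli_gf ^+ 2.
Proof.
have EB := bernoulli_gfVM; set E := Fps _ in EB.
have dE : euler_op E = 1 + fps_var * E - E.
  apply: fpsP => n.
  rewrite -[RHS]/((n == 0%N)%:R + (fps_var * E) n - E n) coef_fps_varM.
  case: n => [|n] /=; first by apply/eqP.
  rewrite add0r (factS n.+1) natrM.
  have := natr_fact_neq0 n.+1; set u := _%:R => u0.
  by rewrite [n.+2%:R]mulrS; field; rewrite u0 /= -!mulrS pnatr_eq0.
have /eqP : euler_op (E * bernoulli_gf) = 0.
  rewrite EB; apply: fpsP => -[|n] /=; first by rewrite mul0r.
  by rewrite mulr0.
rewrite euler_opM addr_eq0 dE => /eqP H.
have -> : euler_op bernoulli_gf = - (bernoulli_gf * ((1 + fps_var * E - E) * bernoulli_gf)).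
  by rewrite H mulrN opprK mulrA [bernoulli_gf * E]mulrC EB mul1r.
transitivity (- (bernoulli_gf ^+ 2 + (fps_var * bernoulli_gf) * (E * bernoulli_gf)
   - bernoulli_gf * (E * bernoulli_gf))); first by ring.
by rewrite EB; ring.
Qed.

(* (x/2) coth (x/2) *)
Definition half_coth : fps rat := locked (bernoulli_gf + 2^-1 *: fps_var).

Lemma half_cothE : half_coth = bernoulli_gf + 2^-1 *: fps_var.
Proof. by rewrite /half_coth -lock. Qed.

(** Completing the square: B^2 + x B = (B + x/2)^2 - x^2/4. *)
Lemma half_coth_riccati :
  euler_op half_coth = half_coth + 4^-1 *: fps_var ^+ 2 - half_coth ^+ 2.
Proof.
rewrite half_cothE.
have -> : euler_op (bernoulli_gf + 2^-1 *: fps_var)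
  = euler_op bernoulli_gf + 2^-1 *: fps_var.
  by apply: fpsP => -[|[|n]] /=; rewrite ?mulr0 ?mul0r ?addr0 ?mulr1 ?mul1r.
rewrite euler_op_bernoulli.
(* The scalar 1/2 becomes a ring element [w] known only through w + w = 1, which brings the identity
   within reach of [ring]. *)
have H2 : (2^-1)%:A + (2^-1)%:A = 1 :> fps rat by rewrite -scalerDl scale1r.
have H4 : (4^-1)%:A = (2^-1)%:A * (2^-1)%:A :> fps rat by rewrite -scalerAl mul1r scalerA.
rewrite -[4^-1 *: _]mulr_algl H4 -[2^-1 *: fps_var]mulr_algl.
set w := (2^-1)%:A in H2 *.
rewrite -[fps_var * bernoulli_gf]mul1r -H2; ring.
Qed.

Lemma half_coth0 : half_coth 0 = 1.
Proof.
have := bernoulli_gfVM => /(congr1 (fun f : fps rat => f 0%N)).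
by rewrite coef_fpsM big_ord1 /= half_cothE /= invr1 mul1r mulr0 addr0 => ->.
Qed.

Lemma coef_fps_var2 (n : nat) : (fps_var ^+ 2) n = (n == 2)%:R.
Proof. by rewrite expr2 coef_fps_varM; case: n. Qed.

(** The two end terms of the square each equal the coefficient n + 1, as the constant term is 1;
    moved to the left they produce the factor n + 2. *)
Lemma half_coth_rec (n : nat) :
  n.+2%:R * half_coth n.+1 =
  4^-1 * (n == 1%N)%:R - \sum_(i < n) half_coth i.+1 * half_coth (n - i)%N.
Proof.
have /(congr1 (fun f : fps rat => f n.+1)) := half_coth_riccati.
rewrite -[LHS]/(n.+1%:R * half_coth n.+1).
rewrite -[RHS]/(half_coth n.+1 + 4^-1 * (fps_var ^+ 2) n.+1 - (half_coth ^+ 2) n.+1).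
rewrite coef_fps_var2 expr2 coef_fpsM eqSS big_ord_recl big_ord_recr /=.
rewrite subn0 subnn half_coth0 mul1r mulr1.
under eq_bigr do rewrite /bump leq0n add1n subSS.
set S := bigop.body _ _ _; set y := half_coth n.+1 => H.
by rewrite [n.+2%:R]mulrS mulrDl H; ring.
Qed.

(** By the recursion all products of lower coefficients carry the same sign, so nothing cancels and
    the even coefficients alternate strictly. This is what shows that B_2k is nonzero. *)
Lemma half_coth_sign (n : nat) :
  (odd n -> half_coth n = 0) /\
  ((0 < n)%N -> ~~ odd n -> 0 < (-1) ^+ (n./2).+1 * half_coth n).
Proof.
elim/ltn_ind: n => -[|[|n]] IH; first by [].
  split=> // _; have := half_coth_rec 0; rewrite big_ord0 mulr0 subr0 => /eqP.
  by rewrite mulf_eq0 /= => /eqP.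
have key (i : 'I_n.+1) : half_coth i.+1 * half_coth (n.+1 - i)%N = 0 \/
    0 < (-1) ^+ ((n.+2)./2) * (half_coth i.+1 * half_coth (n.+1 - i)%N) /\ ~~ odd n.
  have lt1 : (i.+1 < n.+2)%N by rewrite ltnS.
  have lt2 : (n.+1 - i < n.+2)%N by rewrite ltnS leq_subr.
  have [o1 e1] := IH _ lt1; have [o2 e2] := IH _ lt2.
  case: (boolP (odd i.+1)) => [/o1 ->|ev1]; first by left; rewrite mul0r.
  case: (boolP (odd (n.+1 - i))) => [/o2 ->|ev2]; first by left; rewrite mulr0.
  right; split; last by lia.
  have n1i : (0 < n.+1 - i)%N by rewrite subn_gt0.
  have := mulr_gt0 (e1 isT ev1) (e2 n1i ev2).
  have -> : ((n.+2)./2 = (i.+1)./2 + (n.+1 - i)./2)%N by lia.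
  rewrite exprD !exprS; set x := half_coth _; set y := half_coth _.
  by rewrite (_ : -1 * _ * x * _ = (-1) ^+ (i.+1)./2 * (-1) ^+ (n.+1 - i)./2 * (x * y)) //; ring.
have R := half_coth_rec n.+1.
have n3 : 0 < n.+3%:R :> rat by rewrite ltr0n.
split=> [on|_ evn].
  have : n.+3%:R * half_coth n.+2 = 0.
    rewrite R (_ : (n.+1 == 1)%N = false) ?mulr0 ?sub0r; last by lia.
    rewrite big1 ?oppr0 // => i _; case: (key i) => // -[_ H]; lia.
  by move/eqP; rewrite mulf_eq0 (gt_eqF n3) => /eqP.
rewrite -(pmulr_rgt0 _ n3) mulrCA R.
(* The coefficient of x^2 is the base case: its positivity comes from the term 1/4, which is absent
   from all later recursions. *)
case: n IH key R n3 evn => [|n] IH key R n3 evn.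
  rewrite big_ord1 /= (IH 1%N isT).1 // mul0r subr0; lra.
rewrite /= mulr0 sub0r mulrN exprS mulN1r mulNr opprK.
rewrite !big_ord_recl !mulrDr ltr_wpDl //.
  by case: (key ord0) => [->|[/ltW //]]; rewrite mulr0.
rewrite ltr_wpDr //.
  rewrite mulr_sumr sumr_ge0 // => i _.
  by case: (key (lift ord0 (lift ord0 i))) => [->|[/ltW //]]; rewrite mulr0.
(* Strictness comes from this term, the product of the coefficients 2 and [n.+1], both nonzero by
   induction. *)
case: (key (lift ord0 ord0)) => [/= |[//]].
have [_ e2] := IH 2%N isT; have [_ en] := IH n.+1 (ltnW (leqnn n.+2)).
move/eqP; rewrite mulf_eq0 => /orP[/eqP h0|/eqP h0].
  by have := e2 isT isT; rewrite h0 mulr0 ltxx.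
have : 0 < (-1) ^+ ((n.+1)./2).+1 * half_coth n.+1 by apply: en => //; lia.
by move: h0; rewrite /bump /= subSS subn0 => ->; rewrite mulr0 ltxx.
Qed.

Lemma half_coth_odd (n : nat) : half_coth (2 * n).+1%N = 0.
Proof. by apply: (half_coth_sign _).1; lia. Qed.

Lemma half_coth_even (n : nat) : (0 < n)%N ->
  half_coth (2 * n)%N = bernoulli (2 * n)%N / (2 * n)%N`!%:R.
Proof.
move=> n0; rewrite bernoulli_gfE mulrAC divff ?natr_fact_neq0 // mul1r half_cothE /=.
by rewrite (_ : _ == 1%N = false) ?mulr0 ?addr0 //; lia.
Qed.

(** [eisenstein] divides by this number, and the weights of the partitions multiply by it again. *)
Lemma bernoulli_neq0 (n : nat) : (0 < n)%N -> bernoulli (2 * n)%N != 0.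
Proof.
move=> n0; have [_ H] := half_coth_sign (2 * n)%N.
have /lt0r_neq0 : 0 < (-1) ^+ (2 * n)./2.+1 * half_coth (2 * n)%N by apply: H; lia.
by rewrite half_coth_even // !mulf_eq0 !negb_or => /and3P[].
Qed.

(** This is (x/2) coth(x/2) (e^x - 1) = (x/2) (e^x + 1), multiplied by e^(cx). *)
Lemma half_coth_exp_diff (c : rat) :
  half_coth * (fps_exp (c + 1) - fps_exp c) =
  2^-1 *: (fps_var * (fps_exp (c + 1) + fps_exp c)).
Proof.
rewrite half_cothE fps_expD -[2^-1 *: fps_var]mulr_algl -[RHS]mulr_algl.
have H2 : (2^-1)%:A + (2^-1)%:A = 1 :> fps rat by rewrite -scalerDl scale1r.
have EB := bernoulli_gf_exp; set w := (2^-1)%:A in H2 *.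
transitivity (bernoulli_gf * (fps_exp 1 - 1) * fps_exp c
   + w * fps_var * (fps_exp c * fps_exp 1 - fps_exp c)); first by ring.
rewrite EB -[fps_var * fps_exp c]mul1r -H2; ring.
Qed.

Definition odd_half (k : nat) : rat := (2 * k + 1)%:R / 2%:R.

Definition cosh2 (k : nat) : fps rat := fps_exp (odd_half k) + fps_exp (- odd_half k).

(** A Dirichlet kernel: coth(x/2) sinh((k + 1/2)x) is a finite sum of cosines. Passing from k to k +
    1 adds one unit step at each end of the interval, and [half_coth_exp_diff] evaluates both. *)
Lemma half_coth_sinh (k : nat) :
  half_coth * (fps_exp (odd_half k) - fps_exp (- odd_half k)) =
  2^-1 *: (fps_var * (cosh2 k + (\sum_(r < k) cosh2 r) *+ 2)).
Proof.
have oS r : odd_half r.+1 = odd_half r + 1.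
  by rewrite /odd_half (_ : (2 * r.+1 + 1)%N = (2 * r + 1) + 2)%N ?natrD; [field|lia].
elim: k => [|k IHk].
  rewrite big_ord0 mul0rn addr0 /cosh2.
  have := half_coth_exp_diff (- odd_half 0).
  by rewrite (_ : - odd_half 0 + 1 = odd_half 0) //; rewrite /odd_half; field.
have D1 := half_coth_exp_diff (odd_half k).
have D2 := half_coth_exp_diff (- odd_half k - 1); rewrite subrK in D2.
rewrite big_ord_recr /= {2}/cosh2 oS opprD.
transitivity (half_coth * (fps_exp (odd_half k + 1) - fps_exp (odd_half k))
 + half_coth * (fps_exp (odd_half k) - fps_exp (- odd_half k))
 + half_coth * (fps_exp (- odd_half k) - fps_exp (- odd_half k - 1))); first by ring.
rewrite D1 D2 IHk -!scalerDr; congr (_ *: _).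
by rewrite /cosh2 oS opprD; ring.
Qed.

(** The coefficient of x^(2t+1) in [half_coth_sinh], multiplied by 4^t to pass from x/2 to x. It
    describes how coth acts on one term of T. *)
Lemma half_coth_faulhaber (k t : nat) :
  \sum_(i < t.+1) 4%:R ^+ i * half_coth (2 * i)%N *
     ((2 * k + 1)%:R ^+ (2 * (t - i)).+1 / (2 * (t - i)).+1`!%:R) =
  ((2 * k + 1)%:R ^+ (2 * t) + 2%:R * \sum_(r < k) (2 * r + 1)%:R ^+ (2 * t))
   / (2 * t)`!%:R.
Proof.
have /(congr1 (fun f : fps rat => f (2 * t).+1)) := half_coth_sinh k.
set S := \sum_(r < k) _.
rewrite -[RHS]/(2^-1 * (fps_var * (cosh2 k + S *+ 2)) (2 * t).+1) coef_fps_varM.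
have cosh2E r : cosh2 r (2 * t)%N = 2%:R * odd_half r ^+ (2 * t) / (2 * t)`!%:R.
  by rewrite /= !exprM sqrrN; ring.
rewrite -[(cosh2 k + S *+ 2) (2 * t)%N]/(cosh2 k (2 * t)%N + (S (2 * t)%N + S (2 * t)%N)).
rewrite coef_fps_sum cosh2E; under eq_bigr do rewrite cosh2E.
rewrite coef_fpsM (_ : (2 * t).+2 = 2 * t.+1)%N; last by lia.
rewrite (sum_pairs (fun i => half_coth i *
  (fps_exp (odd_half k) - fps_exp (- odd_half k)) ((2 * t).+1 - i)%N)) => H.
have E4 : 2%:R ^+ (2 * t) = 4%:R ^+ t :> rat by rewrite exprM.
have {}H := congr1 (fun x => 4%:R ^+ t * x) H.
have ohE r : (2 * r + 1)%:R ^+ (2 * t) = 4%:R ^+ t * odd_half r ^+ (2 * t) :> rat.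
  by rewrite -E4 -exprMn; congr (_ ^+ _); rewrite /odd_half; field.
apply: (etrans _ (etrans H _)).
  rewrite mulr_sumr.
  apply: eq_bigr => i _; rewrite half_coth_odd mul0r addr0.
  have it : (i <= t)%N by rewrite -ltnS.
  rewrite (_ : (2 * t).+1 - 2 * i = (2 * (t - i)).+1)%N; last by lia.
  rewrite (_ : 4%:R ^+ t = 4%:R ^+ i * 2%:R ^+ (2 * (t - i))); last first.
    by rewrite exprM -exprD subnKC.
  rewrite (_ : (2 * k + 1)%:R = 2%:R * odd_half k); last by rewrite /odd_half; field.
  rewrite /= exprNn -signr_odd /= oddM /= expr1 exprMn exprS.
  by ring.
rewrite ohE; under [in RHS]eq_bigr do rewrite ohE.
rewrite -mulr_suml -!mulr_sumr; set T := \sum_(r < k) _.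
by field; exact: natr_fact_neq0.
Qed.

(** * Theta moments *)

(** Presents a sum over r < k as a series over all pairs, to which the reindexing lemmas apply; the
    exponent depends on k alone. *)
Lemma qseries_fold (d : nat -> nat -> rat) (e : nat -> nat) : finite_fibers e ->
  qseries (fun x : nat * nat => if (x.2 < x.1)%N then d x.1 x.2 else 0)
          (fun x => e x.1) =
  qseries (fun k => \sum_(r < k) d k r) e.
Proof.
move=> fe; apply: fpsP => n; have [s us sP] := fiber_enum n.+1 fe.
rewrite (coef_qseries (s := [seq (k, r) | k <- s, r <- iota 0 k])); first last.
- move=> [k r] /= ek; case: ltnP => [rk _|]; last by rewrite eqxx.
  apply/allpairsPdep; exists k, r; split=> //; last by rewrite mem_iota.
  by apply: sP; rewrite ek.
- apply: allpairs_uniq_dep => // [k _|]; first exact: iota_uniq.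
  by move=> _ _ /allpairsPdep[x [y [_ _ ->]]] /allpairsPdep[z [w [_ _ ->]]] [-> ->].
rewrite (coef_qseries (s := s)) // => [|k ek _]; last by apply: sP; rewrite ek.
rewrite [LHS]big_mkcond big_allpairs_dep /= [RHS]big_mkcond.
apply: eq_bigr => k _; case: ifP => _; last by rewrite big1.
rewrite -(big_mkord xpredT) /index_iota subn0 big_seq [RHS]big_seq.
by apply: eq_bigr => r; rewrite mem_iota => /= ->.
Qed.

Lemma sgz_congr (k l d : int) : k = l + 2 * d -> (-1) ^ k = (-1) ^ l :> rat.
Proof.
by move=> ->; rewrite expfzDr // -exprz_exp (_ : (-1) ^ 2 = 1) // exp1rz mulr1.
Qed.

Lemma sgz_opp (k l d : int) : k = l + 2 * d + 1 -> (-1) ^ k = - (-1) ^ l :> rat.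
Proof. by move=> ->; rewrite expfzDr // expr1z (@sgz_congr _ l d) // mulrN1. Qed.

Definition tri (n : nat) : nat := ((n * (n + 1)) %/ 2)%N.

Lemma triE (n : nat) : (tri n * 2 = n * (n + 1))%N.
Proof. by rewrite /tri divnK // dvdn2 oddM addn1 /= andbN. Qed.

Definition triz (k : int) : nat := `|((k * (k + 1)) %/ 2)%Z|%N.

Lemma trizE (k : int) : (triz k)%:Z * 2 = k * (k + 1).
Proof.
have [x eqx] : exists x : int, k * (k + 1) = x * 2.
  have [m [->|->]] : exists m, k = 2 * m \/ k = 2 * m + 1.
    by exists (k %/ 2)%Z; lia.
  - by exists (m * (2 * m + 1)); ring.
  by exists ((2 * m + 1) * (m + 1)); ring.
rewrite /triz eqx mulzK //; have : 0 <= x by nia.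
by lia.
Qed.

Lemma tri_fibers : finite_fibers tri.
Proof. exact: finite_thetaU_fiber. Qed.

Lemma triz_fibers : finite_fibers triz.
Proof.
move=> m; apply: (@sub_finite_set _ _
  [set` [seq k%:Z - (m + 1)%:Z | k <- iota 0 (2 * m + 3)%N]]); last exact: finite_seq.
move=> /= k km; have := trizE k; rewrite km => eqk.
by apply/mapP; exists (absz (k + (m + 1)%:Z)); [rewrite mem_iota; nia | nia].
Qed.

(** The j-th moment of T(x), summed over all integers. The symmetry k -> -1 - k kills the even
    moments and doubles the odd ones. *)
Definition thetaZ (j : nat) : fps rat :=
  qseries (fun k : int => (-1) ^ k * (2 * k + 1)%:~R ^+ j) triz.

Lemma thetaZ_even (j : nat) : ~~ odd j -> thetaZ j = 0.
Proof.
move=> ej; apply: (@qseries_involution _ _ _ (fun k => - 1 - k)) => k _.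
split; first by ring.
  rewrite (@sgz_opp (- 1 - k) k (- 1 - k)); last by ring.
  rewrite mulNr (_ : 2 * (- 1 - k) + 1 = - (2 * k + 1)); last by ring.
  by rewrite mulrNz exprNn -signr_odd (negPf ej) mul1r.
by have := trizE k; have := trizE (- 1 - k); nia.
Qed.

Lemma thetaZ_odd (j : nat) : odd j -> thetaZ j = 2%:R *: thetaU j.
Proof.
move=> oj; rewrite /thetaZ; set c := fun k : int => _.
have -> : qseries c triz = qseries (fun k => (if 0 <= k then c k else 0)
     + (if k < 0 then c k else 0)) triz.
  by apply: eq_qseries => // k; rewrite ltNge; case: ifP => _; rewrite ?addr0 ?add0r.
rewrite (qseriesD _ _ triz_fibers) scaler_nat mulr2n.
have cE n : c n%:Z = (-1) ^+ n * (2 * n + 1)%:R ^+ j.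
  by rewrite -[(2 * n + 1)%:R]/((2 * n + 1)%N%:Z%:~R) PoszD PoszM.
have cN n : c (- 1 - n%:Z) = c n.
  rewrite /c (@sgz_opp (- 1 - n%:Z) n (- 1 - n%:Z)); last by ring.
  rewrite (_ : 2 * (- 1 - n%:Z) + 1 = - (2 * n%:Z + 1)); last by ring.
  by rewrite mulrNz exprNn -signr_odd oj expr1 mulN1r mulrNN.
congr (_ + _).
  apply: (@qseries_reindex _ _ _ _ _ _ _ absz Posz) => [k|n _].
    case: ifP => [k0 _|]; last by rewrite eqxx.
    rewrite -cE (_ : `|k|%N%:Z = k); last by lia.
    by split=> //; have := triE `|k|; have := trizE k; rewrite /tri; nia.
  by rewrite /= cE; split=> //; have := triE n; have := trizE n; rewrite /tri; nia.
apply: (@qseries_reindex _ _ _ _ _ _ _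
  (fun k : int => absz (- 1 - k)%R) (fun n : nat => - 1 - n%:Z)).
  move=> k; case: ifP => [k0 _|]; last by rewrite eqxx.
  rewrite -cE -cN (_ : (absz (- 1 - k)%R)%:Z = - 1 - k); last by lia.
  split=> //; [by ring|by congr c; ring|].
  by have := triE (absz (- 1 - k)%R); have := trizE k; rewrite /tri; nia.
move=> n _; rewrite cN cE (_ : - 1 - n%:Z < 0); last by lia.
split=> //; first by lia.
by have := triE n; have := trizE (- 1 - n%:Z); rewrite /tri; nia.
Qed.

Definition lambert (i : nat) : fps rat :=
  Fps (fun n => if n is 0%N then 0 else (sigma i n)%:R).

Lemma lambert_fibers : finite_fibers (fun y : nat * nat => y.1.+1 * y.2.+1)%N.
Proof.
move=> m; apply: (@sub_finite_set _ _ (`I_m.+1 `*` `I_m.+1)); last exact: finite_setX.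
by move=> [x y] /= <-; split=> /=; nia.
Qed.

(** Pairs are grouped by their product, [y.2.+1] being the divisor. The factor 1 stands for the sign
    expected by [qseries_moment]. *)
Lemma lambertE (i : nat) :
  qseries (fun y : nat * nat => 1 * (2 * y.2.+1)%N%:R ^+ i) (fun y => y.1.+1 * y.2.+1)%N
  = 2%:R ^+ i *: lambert i.
Proof.
apply: fpsP => m.
pose s := if m == 0%N then [::] else [seq ((m %/ d).-1, d.-1) | d <- divisors m].
rewrite (coef_qseries (s := s)) /s; last first.
- case=> x y /= xy _; case: eqP => [|/eqP m0]; first by lia.
  apply/mapP; exists y.+1; last by rewrite -xy mulnK.
  by rewrite -dvdn_divisors ?lt0n // -xy dvdn_mull.
- case: eqP => // /eqP m0; rewrite map_inj_in_uniq ?divisors_uniq // => d d'.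
  rewrite -!dvdn_divisors ?lt0n // => /dvdn_gt0 d0 /dvdn_gt0 d'0 [_].
  by have := d0; have := d'0; rewrite lt0n; lia.
case: m {s} => [|m]; first by rewrite big_nil /= mulr0.
rewrite big_map /= /sigma natr_sum mulr_sumr big_seq_cond [RHS]big_seq.
rewrite -big_seq_cond big_seq_cond.
apply: eq_big => [d|d /andP[dm _]].
  case: (boolP (d \in _)) => //=; rewrite -dvdn_divisors // => dm.
  have d0 := dvdn_gt0 (ltn0Sn m) dm; have q0 : (0 < m.+1 %/ d)%N by rewrite divn_gt0 // dvdn_leq.
  by rewrite !prednK // divnK // eqxx.
have d0 : (0 < d)%N by move: dm; rewrite -dvdn_divisors // => /dvdn_gt0; apply.
by rewrite prednK // mul1r natrM exprMn natrX.
Qed.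

(** * The logarithmic derivative of theta *)

(* A triple (k, (n, m)) is the term of \sum_k, \sum_(n,m >= 1) with indices
   (k, n + 1, m + 1).  With M := m + 1, r := k + M and N := n + 1 - r, its q-exponent
   is r(r+1)/2 + M(M-1)/2 + MN and its sign is (-1)^(r+M); for even [j] its
   weight (2r+1)^j is invariant under r -> -1 - r. *)
Definition theta_lambert (j : nat) : fps rat :=
  qseries (fun x : int * (nat * nat) =>
             (-1) ^ x.1 * (2 * (x.1 + x.2.2.+1%:Z) + 1)%:~R ^+ j)
          (fun x => triz x.1 + x.2.1.+1 * x.2.2.+1)%N.

(* The terms that survive the cancellation have r >= 0 and either N = r + 1, or
   N <= 0 and M = 1 - 2N. *)
Definition tl_diag (k : int) (n m : nat) : bool :=
  (0 <= k + m.+1%:Z) && (n%:Z == 2 * (k + m.+1%:Z)).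

Definition tl_fixed (k : int) (n m : nat) : bool :=
  [&& 0 <= k + m.+1%:Z, n.+1%:Z <= k + m.+1%:Z & m%:Z == 2 * (k + m%:Z - n%:Z)].

(* The three cases are (r, N, M) -> (-1 - r, N, M), (r, N, 1 - 2N - M) and
   (r, 1 - N, M + 2N - 1); each preserves the q-exponent and flips the sign. *)
Definition tl_fold (x : int * (nat * nat)) : int * (nat * nat) :=
  let: (k, (n, m)) := x in
  let r := k + m.+1%:Z in let N := n.+1%:Z - r in
  if (r < 0) || (r + 2 <= N) then (- 3 - k - 2 * m%:Z, (absz (n%:Z - 2 * r - 1)%R, m))
  else if (N <= 0) && (m.+1%:Z <= - 2 * N) then
    (r - (1 - 2 * N - m.+1%:Z), (n, absz (- 2 * N - m.+1%:Z)%R))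
  else (k - 2 * N + 1, (absz (2 * r - n%:Z - 1)%R, absz (m%:Z + 2 * N - 1)%R)).

Arguments tl_fold : simpl never.

(** The graph of [tl_fold] as linear relations over the integers, free of absolute values, so that
    its properties become arithmetic case checks. *)
Definition tl_fold_spec (k : int) (n m : nat) (k' : int) (n' m' : nat) : Prop :=
  let r := k + m.+1%:Z in let N := n.+1%:Z - r in
  [\/ [/\ (r < 0) || (r + 2 <= N), k' = - 3 - k - 2 * m%:Z, n'%:Z = n%:Z - 2 * r - 1 & m' = m],
      [/\ 0 <= r, N <= 0, m.+1%:Z <= - 2 * N &
         [/\ k' = r - m'.+1%:Z, n' = n & m'.+1%:Z = 1 - 2 * N - m.+1%:Z] ] |
      [/\ 0 <= r, N <= r, (1 <= N) || (2 - 2 * N <= m.+1%:Z) &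
         [/\ k' = r - m'.+1%:Z, n'.+1%:Z = 1 - N + r & m'.+1%:Z = m.+1%:Z + 2 * N - 1] ] ].

Lemma tl_foldP k n m : ~~ tl_diag k n m -> ~~ tl_fixed k n m ->
  let y := tl_fold (k, (n, m)) in tl_fold_spec k n m y.1 y.2.1 y.2.2.
Proof.
rewrite /tl_diag /tl_fixed /tl_fold /tl_fold_spec => H1 H2.
case: ifP => [c1|c1]; first by apply: Or31 => /=; split=> //; lia.
case: ifP => [c2|c2].
  by apply: Or32 => /=; split; try lia; split; lia.
by apply: Or33 => /=; split; try lia; split; lia.
Qed.

Lemma tl_fold_spec_region k n m k' n' m' : tl_fold_spec k n m k' n' m' ->
  ~~ tl_diag k' n' m' /\ ~~ tl_fixed k' n' m'.
Proof.
rewrite /tl_diag /tl_fixed.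
case=> [[]|[] ? ? ? []|[] ? ? ? []] *; split; lia.
Qed.

(** Each of the three regions is stable under its own map, which is an involution there; two
    different cases in succession have contradictory inequalities. *)
Lemma tl_fold_spec_inv k n m k' n' m' k'' n'' m'' :
  tl_fold_spec k n m k' n' m' -> tl_fold_spec k' n' m' k'' n'' m'' ->
  (k'', (n'', m'')) = (k, (n, m)).
Proof.
move=> H1 H2; suff [-> -> ->] : [/\ k'' = k, n'' = n & m'' = m] by [].
case: H1 => [[]|[] ? ? ? []|[] ? ? ? []] *;
case: H2 => [[]|[] ? ? ? []|[] ? ? ? []] *; split; lia.
Qed.

Lemma tl_fold_spec_exponent k n m k' n' m' : tl_fold_spec k n m k' n' m' ->
  (triz k' + n'.+1 * m'.+1 = triz k + n.+1 * m.+1)%N.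
Proof.
move=> H; suff : (triz k')%:Z * 2 + 2 * (n'.+1%:Z * m'.+1%:Z)
   = (triz k)%:Z * 2 + 2 * (n.+1%:Z * m.+1%:Z) by lia.
rewrite !trizE.
case: H => [[_ -> En ->]|[_ _ _ [-> -> Em]]|[_ _ _ [-> En Em]]].
- by rewrite -[n'.+1]addn1 PoszD En -[m.+1]addn1 -[n.+1]addn1 !PoszD; ring.
- by rewrite Em; ring.
- by rewrite En Em; ring.
Qed.

Lemma tl_fold_spec_sign k n m k' n' m' : tl_fold_spec k n m k' n' m' ->
  (-1) ^ k' = - (-1) ^ k :> rat /\
  (2 * (k' + m'.+1%:Z) + 1 = 2 * (k + m.+1%:Z) + 1 \/
   2 * (k' + m'.+1%:Z) + 1 = - (2 * (k + m.+1%:Z) + 1)).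
Proof.
case=> [[_ Ek En Em]|[_ _ _ [Ek _ Em]]|[_ _ _ [Ek En Em]]]; split; try lia.
- by apply: (@sgz_opp k' k (- 2 - k - m%:Z)); lia.
- by apply: (@sgz_opp k' k (m%:Z + n.+1%:Z - k - m.+1%:Z)); lia.
- by apply: (@sgz_opp k' k (k + m.+1%:Z - n.+1%:Z)); lia.
Qed.

Lemma tl_fibers :
  finite_fibers (fun x : int * (nat * nat) => triz x.1 + x.2.1.+1 * x.2.2.+1)%N.
Proof. exact: finite_fibersM triz_fibers lambert_fibers. Qed.

(** The diagonal terms are indexed by K = r + M and r < K, the fixed ones by K = r and p = - N < K;
    the latter do not depend on p. *)
Lemma theta_lambertE (j : nat) : ~~ odd j ->
  theta_lambert j =
  qseries (fun K : nat => \sum_(r < K) (-1) ^+ K *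
             ((2 * r + 1)%:R ^+ j - (2 * K + 1)%:R ^+ j)) tri.
Proof.
move=> ej; rewrite /theta_lambert; set e := fun x : int * (nat * nat) => (_ + _)%N.
set c := fun x : int * (nat * nat) => _.
pose reg (p : int -> nat -> nat -> bool) (x : int * (nat * nat)) := p x.1 x.2.1 x.2.2.
pose cut p x : rat := if reg p x then c x else 0.
pose tl_rest k n m := ~~ tl_diag k n m && ~~ tl_fixed k n m.
have -> : qseries c e = qseries (cut tl_diag) e + qseries (cut tl_fixed) e
    + qseries (cut tl_rest) e.
  rewrite -!(qseriesD _ _ tl_fibers); apply: eq_qseries => // -[k [n m]].
  rewrite /cut /reg /tl_rest /=.
  case: (boolP (tl_diag k n m)) => [d|_]; case: (boolP (tl_fixed k n m)) => [f|_] /=;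
    rewrite ?addr0 ?add0r //.
  by move: d f; rewrite /tl_diag /tl_fixed; lia.
have -> : qseries (cut tl_rest) e = 0.
  apply: (@qseries_involution _ _ _ tl_fold) => -[k [n m]].
  rewrite /cut; case: ifP => [/andP[/= H1 H2] _|]; last by rewrite eqxx.
  have := tl_foldP H1 H2; case: (tl_fold _) => k' [n' m'] /= S.
  have [H1' H2'] := tl_fold_spec_region S.
  split.
  - have := tl_foldP H1' H2'; case: (tl_fold _) => k'' [n'' m''] /= S'.
    exact: tl_fold_spec_inv S S'.
  - rewrite /reg /tl_rest /= H1' H2' /= /c /=.
    have [-> [->|->]] := tl_fold_spec_sign S; first by rewrite mulNr.
    by rewrite mulrNz exprNn -signr_odd (negPf ej) mul1r mulNr.
  - exact: tl_fold_spec_exponent S.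
pose d1 (K r : nat) : rat := (-1) ^+ K * (2 * r + 1)%:R ^+ j.
pose d2 (K p : nat) : rat := - ((-1) ^+ K * (2 * K + 1)%:R ^+ j).
have castE (k : nat) : (2 * k%:Z + 1)%:~R = (2 * k + 1)%:R :> rat.
  by rewrite -[(2 * k + 1)%:R]/((2 * k + 1)%N%:Z%:~R) PoszD PoszM.
(* For N = r + 1 the exponent r(r+1)/2 + M(M-1)/2 + MN is the triangular number of r + M. *)
have -> : qseries (cut tl_diag) e = qseries (fun K => \sum_(r < K) d1 K r) tri.
  rewrite -(qseries_fold _ tri_fibers).
  apply: (@qseries_reindex _ _ _ _ _ _ _
    (fun x => (absz (x.1 + 2 * x.2.2.+1%:Z)%R, absz (x.1 + x.2.2.+1%:Z)%R))
    (fun y => (2 * y.2%:Z - y.1%:Z, ((2 * y.2)%N, (y.1 - y.2).-1)))).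
    case=> k [n m]; rewrite /cut /reg /=; case: ifP => [D _|]; last by rewrite eqxx.
    have [r Er] : exists r : nat, k + m.+1%:Z = r.
      by exists (absz (k + m.+1%:Z)%R); move: D; rewrite /tl_diag; lia.
    have -> : absz (k + m.+1%:Z)%R = r by lia.
    have -> : absz (k + 2 * m.+1%:Z)%R = (r + m.+1)%N by lia.
    rewrite (_ : (r < r + m.+1)%N); last by lia.
    split.
    - by congr (_, (_, _)); move: D; rewrite /tl_diag; lia.
    - rewrite /c /d1 /= Er castE; congr (_ * _).
      by rewrite exprnP; apply: (@sgz_congr _ k m.+1); lia.
    - have := triE (r + m.+1); have := trizE k; move: D; rewrite /tl_diag /e /=; nia.
  case=> K r /=; case: ifP => [rK _|]; last by rewrite eqxx.
  have E1 : 2 * r%:Z - K%:Z + (K - r).-1.+1%:Z = r by lia.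
  have D : tl_diag (2 * r%:Z - K%:Z) (2 * r) (K - r).-1.
    by rewrite /tl_diag E1; lia.
  rewrite /cut /reg /= D /c /= E1 castE; split.
  - by congr (_, _); lia.
  - by congr (_ * _); rewrite exprnP; apply: (@sgz_congr _ _ (r%:Z - K%:Z)); lia.
  - have := triE K; have := trizE (2 * r%:Z - K%:Z); rewrite /e /=.
    have -> : K = (r + (K - r).-1.+1)%N by lia.
    by move: (K - r).-1 => m; nia.
(* For M = 1 - 2N one has M(M-1)/2 = - MN, which leaves the exponent r(r+1)/2. *)
have -> : qseries (cut tl_fixed) e = qseries (fun K => \sum_(r < K) d2 K r) tri.
  rewrite -(qseries_fold _ tri_fibers).
  apply: (@qseries_reindex _ _ _ _ _ _ _
    (fun x => (absz (x.1 + x.2.2.+1%:Z)%R, (x.2.2)./2))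
    (fun y => (y.1%:Z - 2 * y.2%:Z - 1, ((y.1 - y.2).-1, (2 * y.2)%N)))).
    case=> k [n m]; rewrite /cut /reg /=; case: ifP => [D _|]; last by rewrite eqxx.
    have [r Er] : exists r : nat, k + m.+1%:Z = r.
      by exists (absz (k + m.+1%:Z)%R); move: D; rewrite /tl_fixed; lia.
    have [p Ep] : exists p : nat, m = (2 * p)%N.
      by exists (m./2); move: D; rewrite /tl_fixed; lia.
    have -> : absz (k + m.+1%:Z)%R = r by lia.
    have -> : (m./2 = p)%N by lia.
    have pr : (p < r)%N by move: D; rewrite /tl_fixed; lia.
    rewrite pr; split.
    - by congr (_, (_, _)); move: D; rewrite /tl_fixed; lia.
    - rewrite /c /d2 /= Er castE -mulNr; congr (_ * _).
      rewrite exprnP (@sgz_opp r k p) ?opprK //; lia.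
    - have := triE r; have := trizE k; rewrite /e /=.
      have -> : n = (r - p).-1 by move: D; rewrite /tl_fixed; lia.
      by move: pr; rewrite Ep; nia.
  case=> K p /=; case: ifP => [pK _|]; last by rewrite eqxx.
  have E1 : K%:Z - 2 * p%:Z - 1 + (2 * p).+1%:Z = K by lia.
  have D : tl_fixed (K%:Z - 2 * p%:Z - 1) (K - p).-1 (2 * p).
    by rewrite /tl_fixed E1; lia.
  rewrite /cut /reg /= D /c /= E1 castE; split.
  - by congr (_, _); lia.
  - rewrite /d2 -[RHS]mulNr; congr (_ * _).
    by rewrite exprnP (@sgz_opp K (K%:Z - 2 * p%:Z - 1) p) ?opprK //; lia.
  - have := triE K; have := trizE (K%:Z - 2 * p%:Z - 1); rewrite /e /=.
    have -> : K = (p + (K - p).-1.+1)%N by lia.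
    by move: (K - p).-1 => m; nia.
rewrite addr0 -(qseriesD _ _ tri_fibers); apply: eq_qseries => // K.
by rewrite -big_split; apply: eq_bigr => r _; rewrite /d1 /d2 mulrBr.
Qed.

(** * The quintuple product identity *)

Definition pent (n : int) : nat := `|((n * (3 * n + 1)) %/ 2)%Z|%N.

Lemma pentE (n : int) : (pent n)%:Z * 2 = n * (3 * n + 1).
Proof. exact: thetaV_exponent. Qed.

Lemma pent_fibers : finite_fibers pent.
Proof. exact: finite_thetaV_fiber. Qed.

(** Moments of \sum_n (-1)^n q^(n(3n+1)/2) e^((6n+1)x) times T(x). As T is odd, the odd moments see
    only the cosh part of the exponential. *)
Definition thetaVZ (j : nat) : fps rat :=
  qseries (fun x : int * int =>
      (-1) ^ x.1 * (-1) ^ x.2 * ((6 * x.1 + 1)%:~R + (2 * x.2 + 1)%:~R) ^+ j)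
    (fun x => pent x.1 + triz x.2)%N.

Lemma thetaVZ_odd (j : nat) : odd j ->
  thetaVZ j = 2%:R ^+ j *: (thetaV 0 * thetaU j).
Proof.
move=> oj; apply: (@scalerI rat (fps rat) 2%:R) => //.
rewrite scalerA mulrC -scalerA scalerAr -thetaZ_odd //.
have -> : thetaV 0 = qseries (fun n : int => (-1) ^ n) pent.
  by apply: eq_qseries => // n; rewrite expr0 mulr1.
rewrite (qseriesM _ _ pent_fibers triz_fibers) /thetaVZ.
have fe : finite_fibers (fun x : int * int => pent x.1 + triz x.2)%N.
  exact: finite_fibersM pent_fibers triz_fibers.
set e := fun x : int * int => (_ + _)%N.
(* The change of variables used for [c_even] has integral values of the right residues exactly when
   n + m is even. *)
pose ev (x : int * int) := ((x.1 + x.2) %% 2 == 0)%Z.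
pose even_part (c : int * int -> rat) x := if ev x then c x else 0.
pose odd_part (c : int * int -> rat) x := if ev x then 0 else c x.
have splitE c : qseries c e = qseries (even_part c) e + qseries (odd_part c) e.
  rewrite -(qseriesD _ _ fe); apply: eq_qseries => // x.
  by rewrite /even_part /odd_part; case: ifP => _; rewrite ?addr0 ?add0r.
set c := fun x : int * int => _ * _ ^+ j; set d := fun x : int * int => _ * (_ * _).
have cE n m : c (n, m) = (-1) ^ n * (-1) ^ m * (6 * n + 2 * m + 2)%:~R ^+ j.
  by rewrite /c /= -intrD; congr (_ * _%:~R ^+ _); ring.
have dE n m : d (n, m) = (-1) ^ n * (-1) ^ m * (2 * m + 1)%:~R ^+ j.
  by rewrite /d /= mulrA.
have NE (x : int) : (- x)%:~R ^+ j = - x%:~R ^+ j :> rat.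
  by rewrite mulrNz exprNn -signr_odd oj expr1 mulN1r.
have eE n m n' m' : n * (3 * n + 1) + m * (m + 1) = n' * (3 * n' + 1) + m' * (m' + 1) ->
    e (n, m) = e (n', m').
  by rewrite -!pentE -!trizE /e /=; lia.
have d_odd : qseries (odd_part d) e = qseries (even_part d) e.
  have H n m : d (n, - 1 - m) = d (n, m).
    rewrite !dE (@sgz_opp (- 1 - m) m (- 1 - m)); last by ring.
    by rewrite (_ : 2 * (- 1 - m) + 1 = - (2 * m + 1)) ?NE ?mulrN ?mulNr ?opprK //; ring.
  have He n m : e (n, - 1 - m) = e (n, m).
    by apply: eE; ring.
  apply: (@qseries_reindex _ _ _ _ _ _ _ (fun x => (x.1, - 1 - x.2)) (fun x => (x.1, - 1 - x.2))).
    case=> n m; rewrite /odd_part /even_part; case: ifP => [_|/= Ex _]; first by rewrite eqxx.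
    rewrite (_ : ev (n, - 1 - m)); last by move: Ex; rewrite /ev /=; lia.
    by rewrite H He; split=> //; congr (_, _); ring.
  case=> n m; rewrite /odd_part /even_part; case: ifP => [/= Ex _|_]; last by rewrite eqxx.
  rewrite (_ : ev (n, - 1 - m) = false); last by move: Ex; rewrite /ev /=; lia.
  by rewrite H He; split=> //; congr (_, _); ring.
have c_odd : qseries (odd_part c) e = 0.
  (* With (a, b) = (2m + 1, 6n + 1) this is (a, b) -> ((a - b)/2, - (3a + b)/2), which preserves
     3a^2 + b^2 and negates a + b. *)
  apply: (@qseries_involution _ _ _ (fun x =>
    (- ((x.2 + x.1 + 1) %/ 2)%Z, ((x.2 - 3 * x.1 - 1) %/ 2)%Z))) => -[n m].
  rewrite /odd_part; case: ifP => [_|/= Ex _]; first by rewrite eqxx.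
  have [u Em] : exists u, m = 2 * u - n - 1.
    by exists ((m + n + 1) %/ 2)%Z; move: Ex; rewrite /ev /=; lia.
  have -> : ((m + n + 1) %/ 2)%Z = u by lia.
  have -> : ((m - 3 * n - 1) %/ 2)%Z = u - 2 * n - 1 by lia.
  rewrite (_ : ev (- u, u - 2 * n - 1) = false); last by rewrite /ev /=; lia.
  split; first by congr (_, _); lia.
    rewrite !cE (_ : 6 * - u + 2 * (u - 2 * n - 1) + 2 = - (6 * n + 2 * m + 2)); last first.
      by rewrite Em; ring.
    rewrite NE mulrN -!expfzDr //; congr (- (_ * _)).
    by apply: (@sgz_congr _ _ (- u - n)); rewrite Em; ring.
  by apply: eE; rewrite Em; ring.
have c_even : qseries (even_part c) e = 2%:R ^+ j *: qseries (even_part d) e.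
  rewrite -qseriesZ.
  (* with (a, b) = (2m + 1, 6n + 1): (a, b) -> ((a + b)/2, (3a - b)/2) *)
  pose h (x : int * int) := (((x.2 - x.1) %/ 2)%Z, ((x.2 + 3 * x.1) %/ 2)%Z).
  have hP x : ev x -> [/\ ev (h x), h (h x) = x, c x = 2%:R ^+ j * d (h x) & e (h x) = e x].
    case: x => n m Ex; have [s Em] : exists s, m = n + 2 * s.
      by exists ((m - n) %/ 2)%Z; move: Ex; rewrite /ev /=; lia.
    have hE : h (n, m) = (s, 2 * n + s) by rewrite /h /=; congr (_, _); lia.
    rewrite hE; split.
    - by rewrite /ev /=; lia.
    - by rewrite /h /=; congr (_, _); lia.
    - rewrite cE dE mulrCA -exprMn -(intrM _ 2) -!expfzDr //; congr (_ * _%:~R ^+ _).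
        by congr (_ ^ _); rewrite Em; ring.
      by rewrite Em; ring.
    - by apply: eE; rewrite Em; ring.
  apply: (@qseries_reindex _ _ _ _ _ _ _ h h) => x; rewrite /even_part.
    by case: (boolP (ev x)) => [/hP[-> -> -> ->]|]; rewrite ?eqxx.
  case: (boolP (ev x)) => [/hP[H1 H2 _ H4]|]; last by rewrite mulr0 eqxx.
  have [_ _ -> _] := hP _ H1; rewrite H1 H2 H4; split=> //.
by rewrite splitE c_odd addr0 c_even [in RHS]splitE d_odd scalerA mulrC -scalerA -mulr2n scaler_nat.
Qed.

(** * Recursions and the theorem *)

(** Up to degree n the sequences may be truncated to polynomials, whose product is associative. *)
Lemma convA (R : comNzRingType) (f g h : nat -> R) (n : nat) :
  \sum_(i < n.+1) f i * (\sum_(j < (n - i).+1) g j * h (n - i - j)%N) =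
  \sum_(i < n.+1) (\sum_(j < i.+1) f j * g (i - j)%N) * h (n - i)%N.
Proof.
have PE (u v : nat -> R) m : (m < n.+1)%N ->
    ((\poly_(i < n.+1) u i) * (\poly_(i < n.+1) v i))`_m = \sum_(i < m.+1) u i * v (m - i)%N.
  move=> mn; rewrite coefM; apply: eq_bigr => i _; rewrite !coef_poly.
  by rewrite (leq_ltn_trans (leq_ord i) mn) (leq_ltn_trans (leq_subr i m) mn).
transitivity ((\poly_(i < n.+1) f i) * ((\poly_(i < n.+1) g i) * (\poly_(i < n.+1) h i)))`_n.
  rewrite coefM; apply: eq_bigr => i _.
  by rewrite coef_poly ltn_ord PE // ltnS leq_subr.
rewrite mulrA coefM; apply: eq_bigr => i _.
by rewrite PE // coef_poly ltnS leq_subr.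
Qed.

Lemma convC (R : comNzRingType) (f g : nat -> R) (n : nat) :
  \sum_(i < n.+1) f i * g (n - i)%N = \sum_(i < n.+1) g i * f (n - i)%N.
Proof.
rewrite (reindex_inj rev_ord_inj) /=; apply: eq_bigr => i _.
by rewrite mulrC subSS subKn // -ltnS.
Qed.

(* x U' = b U, where U = \sum u_n x^n. *)
Definition logder (b u : nat -> fps rat) :=
  forall n, n%:R *: u n = \sum_(k < n.+1) b k * u (n - k)%N.

Lemma logderM (b c u v : nat -> fps rat) : logder b u -> logder c v ->
  logder (fun k => b k + c k) (fun n => \sum_(i < n.+1) u i * v (n - i)%N).
Proof.
move=> ub vc n.
under [RHS]eq_bigr do rewrite mulrDl.
rewrite big_split /= convA.
have -> : \sum_(i < n.+1) c i * (\sum_(j < (n - i).+1) u j * v (n - i - j)%N)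
  = \sum_(i < n.+1) u i * (\sum_(j < (n - i).+1) c j * v (n - i - j)%N).
  rewrite !convA; apply: eq_bigr => i _.
  by rewrite (convC c u).
rewrite -big_split /= scaler_sumr; apply: eq_bigr => i _.
rewrite -ub -vc -scalerAl -scalerAr -scalerDl -natrD subnKC //.
by rewrite -ltnS.
Qed.

(** As b_0 = 0, the right side at n involves only earlier terms, and n is invertible for n > 0. *)
Lemma logder_inj (b u v : nat -> fps rat) : b 0%N = 0 -> u 0%N = v 0%N ->
  logder b u -> logder b v -> u =1 v.
Proof.
move=> b0 uv0 ub vb; elim/ltn_ind => -[//|n] IH.
apply: (@scalerI rat (fps rat) n.+1%:R); first by rewrite pnatr_eq0.
rewrite ub vb big_ord_recl [in RHS]big_ord_recl b0 !mul0r; congr (_ + _).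
by apply: eq_bigr => i _; rewrite IH // lift0 subSS ltnS leq_subr.
Qed.

Lemma logder_scale (s : rat) (b u : nat -> fps rat) : logder b u ->
  logder (fun k => s ^+ k *: b k) (fun n => s ^+ n *: u n).
Proof.
move=> ub n; rewrite scalerA mulrC -scalerA ub scaler_sumr; apply: eq_bigr => i _.
by rewrite -scalerAl -scalerAr scalerA -exprD subnKC // -ltnS.
Qed.

Lemma logder_mulr (f : fps rat) (b u : nat -> fps rat) : logder b u ->
  logder b (fun n => u n * f).
Proof.
move=> ub n; rewrite scalerAl ub mulr_suml.
by apply: eq_bigr => i _; rewrite mulrA.
Qed.

Lemma logder_part_sum (a : nat -> fps rat) : logder (fun k => k%:R *: a k) (part_sum a).
Proof.
move=> n; rewrite part_sum_rec big_ord_recl scale0r mul0r add0r.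
by apply: eq_bigr => i _; rewrite lift0 -scalerAl.
Qed.

Definition coefU (k : nat) : rat := bernoulli (2 * k)%N / ((2 * k)%:R * (2 * k)%N`!%:R).
Definition coefV (k : nat) : rat :=
  (4%:R ^+ k - 1) * bernoulli (2 * k)%N / ((2 * k)%:R * (2 * k)%N`!%:R).

Lemma part_weight_scale (c : nat -> rat) (l : seq nat) :
  part_weight (fun k => c k *: eisenstein k) l =
  (\prod_(1 <= k < (sumn l).+1) ((mult k l)`!%:R^-1 * c k ^+ mult k l))
     *: eisenstein_part l.
Proof.
rewrite /part_weight /eisenstein_part -scaler_prod.
by apply: eq_bigr => k _; rewrite exprZn scalerA.
Qed.

Lemma Tr_part_sum (t : nat) (s : rat) (c : nat -> rat) (phi : seq nat -> rat) :
  (forall l, sumn l = t -> phi l =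
     s * \prod_(1 <= k < t.+1) ((mult k l)`!%:R^-1 * c k ^+ mult k l)) ->
  Tr t phi = s *: part_sum (fun k => c k *: eisenstein k) t.
Proof.
move=> phiE; have fP := finite_partitions t.
rewrite /Tr /part_sum (fsbig_finite _ _ fP) [in RHS](fsbig_finite _ _ fP) scaler_sumr.
apply: eq_big_seq => l; rewrite in_fset_set // inE /= => /and3P[_ _ /eqP lt].
by rewrite part_weight_scale scalerA phiE // lt.
Qed.

(** The coefficients of T(x)/(2x) as a series in x^2. *)
Definition egfU (t : nat) : fps rat := (2 * t).+1%N`!%:R^-1 *: thetaU (2 * t).+1%N.

Lemma theta_lambert_moment (t : nat) :
  theta_lambert (2 * t) = \sum_(l < t) ('C(2 * t, (2 * l).+1)%:R * 2%:R ^+ (2 * l).+2) *: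
     (thetaU (2 * (t - l.+1)).+1 * lambert (2 * l).+1).
Proof.
have -> : theta_lambert (2 * t) = \sum_(i < (2 * t).+1) 'C(2 * t, i)%:R *:
    (thetaZ (2 * t - i) * (2%:R ^+ i *: lambert i)).
  under eq_bigr do rewrite -lambertE.
  rewrite -(qseries_moment _ _ _ _ _ triz_fibers lambert_fibers).
  apply: eq_qseries => // -[k [n m]] /=; rewrite mulr1; congr (_ * _ ^+ _).
  rewrite -[(2 * m.+1)%N%:R]/((2 * m.+1)%N%:Z%:~R) -intrD PoszM; congr _%:~R; ring.
(* The last index meets the vanishing moment [thetaZ 0]; the remaining ones pair up, and only the
   odd one of each pair survives. *)
rewrite big_ord_recr /= subnn thetaZ_even // mul0r scaler0 addr0.
rewrite (sum_pairs (fun i => 'C(2 * t, i)%:R *: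
    (thetaZ (2 * t - i) * (2%:R ^+ i *: lambert i)))).
apply: eq_bigr => l _; have lt := ltn_ord l.
rewrite thetaZ_even ?mul0r ?scaler0 ?add0r; last by lia.
rewrite (_ : 2 * t - (2 * l).+1 = (2 * (t - l.+1)).+1)%N; last by lia.
rewrite thetaZ_odd; last by lia.
by rewrite -scalerAl -scalerAr !scalerA [_ ^+ (2 * l).+2]exprS mulrA.
Qed.

(** Half of the 2t-th moment of T' + 2 T \sum q^(nm) (e^(2mx) - e^(-2mx)) = T coth x, checked
    separately for each K. *)
Lemma thetaU_coth (t : nat) :
  thetaU (2 * t).+1 + 2%:R *: theta_lambert (2 * t) =
  (2 * t)`!%:R *: \sum_(i < t.+1) (4%:R ^+ i * half_coth (2 * i)%N) *: egfU (t - i).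
Proof.
rewrite theta_lambertE; last by lia.
have -> : thetaU (2 * t).+1 = qseries (fun n => (-1) ^+ n * (2 * n + 1)%:R ^+ (2 * t).+1) tri by [].
rewrite -qseriesZ -(qseriesD _ _ tri_fibers).
under [in RHS]eq_bigr do rewrite scalerA.
rewrite -(qseries_sum _ _ tri_fibers) -qseriesZ; apply: eq_qseries => // K.
rewrite -mulr_sumr -mulrCA -mulrDr.
have -> : \sum_(i < t.+1) 4%:R ^+ i * half_coth (2 * i)%N / (2 * (t - i)).+1`!%:R *
    ((-1) ^+ K * (2 * K + 1)%:R ^+ (2 * (t - i)).+1) =
    (-1) ^+ K * \sum_(i < t.+1) 4%:R ^+ i * half_coth (2 * i)%N *
     ((2 * K + 1)%:R ^+ (2 * (t - i)).+1 / (2 * (t - i)).+1`!%:R).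
  by rewrite mulr_sumr; apply: eq_bigr => i _; ring.
rewrite half_coth_faulhaber mulrCA; congr (_ * _).
rewrite mulrCA divff ?natr_fact_neq0 // mulr1.
(* Here (2K+1)^(2t+1) - 2K (2K+1)^(2t) = (2K+1)^(2t). *)
rewrite sumrB sumr_const card_ord -mulr_natr exprS natrD natrM.
set S := \sum_(r < K) _.
by ring.
Qed.

(** Splits E_2k into its constant term, which is the coth part, and its Lambert series, where B_2k
    cancels. *)
Lemma coefU_eisenstein (k : nat) :
  (4%:R ^+ k.+1 * k.+1%:R * 2%:R) *: (coefU k.+1 *: eisenstein k.+1) =
  (4%:R ^+ k.+1 * half_coth (2 * k.+1)%N)%:A
   - (2%:R * 4%:R ^+ k.+1 / (2 * k).+1`!%:R) *: lambert (2 * k).+1.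
Proof.
have B0 := bernoulli_neq0 (ltn0Sn k).
have f0 := natr_fact_neq0 (2 * k).+1.
have k0 : k.+1%:R != 0 :> rat by rewrite pnatr_eq0.
rewrite half_coth_even // /coefU /eisenstein.
rewrite (_ : (2 * k.+1)%N`! = (2 * k.+1) * (2 * k).+1`!)%N; last by rewrite mulnS -factS.
rewrite (natrM _ (2 * k.+1)%N (2 * k).+1`!).
set f := _`!%:R in f0 *; rewrite !natrM; set B := bernoulli _ in B0 *.
set c := k.+1%:R in k0 *; clearbody f B c.
apply: fpsP => -[|n] /=.
  by rewrite !mulr1 mulr0 subr0; field; rewrite f0 k0.
rewrite (_ : 2 * k.+1 - 1 = (2 * k).+1)%N; last by lia.
by rewrite mulr0 sub0r; field; rewrite B0 f0 k0.
Qed.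

Lemma logder_egfU : logder (fun k => 4%:R ^+ k *: (k%:R *: (coefU k *: eisenstein k))) egfU.
Proof.
move=> t; rewrite big_ord_recl !scale0r scaler0 mul0r add0r.
have := thetaU_coth t; rewrite theta_lambert_moment.
have -> : thetaU (2 * t).+1 = ((2 * t)`!%:R * (2 * t).+1%:R) *: egfU t.
  by rewrite -natrM (mulnC _`!) -factS /egfU scalerA divff ?scale1r ?natr_fact_neq0.
have -> : 2%:R *: (\sum_(l < t) ('C(2 * t, (2 * l).+1)%:R * 2%:R ^+ (2 * l).+2) *:
     (thetaU (2 * (t - l.+1)).+1 * lambert (2 * l).+1)) = (2 * t)`!%:R *:
   \sum_(l < t) ((2%:R * 4%:R ^+ l.+1 / (2 * l).+1`!%:R) *: lambert (2 * l).+1) * egfU (t - l.+1).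
  rewrite !scaler_sumr; apply: eq_bigr => l _; have lt := ltn_ord l.
  have -> : thetaU (2 * (t - l.+1)).+1 = (2 * (t - l.+1)).+1`!%:R *: egfU (t - l.+1).
    by rewrite /egfU scalerA divff ?scale1r ?natr_fact_neq0.
  rewrite -[in LHS]scalerAl -[in RHS]scalerAl !scalerA [lambert _ * egfU _]mulrC; congr (_ *: _).
  have lt2 : ((2 * l).+1 <= 2 * t)%N by lia.
  rewrite -(bin_fact lt2) (_ : 2 * t - (2 * l).+1 = (2 * (t - l.+1)).+1)%N; last by lia.
  rewrite (natrM _ 'C(_, _)) (natrM _ (2 * l).+1`!).
  rewrite (_ : 4%:R ^+ l.+1 = 2%:R ^+ (2 * l).+2); last first.
    by rewrite (_ : (2 * l).+2 = 2 * l.+1)%N ?exprM //; lia.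
  by field; exact: natr_fact_neq0.
rewrite -scalerA -scalerDr => /(scalerI (natr_fact_neq0 _)).
(* The term i = 0 of the coth sum is [egfU t]; moving it across turns the factor 2t + 1 coming from
   T' into 2t, as befits T/x. *)
rewrite big_ord_recl muln0 half_coth0 expr0 mulr1 scale1r subn0 => H.
apply: (@scalerI rat (fps rat) 2%:R) => //; rewrite scalerA -natrM.
have -> : (2 * t)%:R *: egfU t = (2 * t).+1%:R *: egfU t - egfU t.
  by rewrite -[(2 * t).+1]addn1 natrD scalerDl scale1r addrK.
have move_sides (x y z w : fps rat) : x + y = z + w -> x - z = w - y.
  by move=> E; rewrite -[w](addKr z) -E; ring.
rewrite (move_sides _ _ _ _ H).
rewrite scaler_sumr -sumrB; apply: eq_bigr => i _; rewrite lift0 scalerAl.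
have -> : 2%:R *: (4%:R ^+ i.+1 *: (i.+1%:R *: (coefU i.+1 *: eisenstein i.+1))) =
    (4%:R ^+ i.+1 * i.+1%:R * 2%:R) *: (coefU i.+1 *: eisenstein i.+1).
  by rewrite !scalerA; congr (_ *: _); ring.
by rewrite coefU_eisenstein mulrBl mulr_algl.
Qed.

Lemma coefV_eisenstein (k : nat) :
  coefV k *: eisenstein k = (4%:R ^+ k - 1) *: (coefU k *: eisenstein k).
Proof. by rewrite scalerA /coefV -mulrA. Qed.

Definition psumU : nat -> fps rat := part_sum (fun k => coefU k *: eisenstein k).
Definition psumV : nat -> fps rat := part_sum (fun k => coefV k *: eisenstein k).

Lemma egfU_psum (t : nat) : egfU t = 4%:R ^+ t *: psumU t * egfU 0.
Proof.
apply: (@logder_inj (fun k => 4%:R ^+ k *: (k%:R *: (coefU k *: eisenstein k))) egfU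
  (fun t => 4%:R ^+ t *: psumU t * egfU 0)).
- by rewrite scale0r scaler0.
- by rewrite expr0 scale1r /psumU part_sum0 mul1r.
- exact: logder_egfU.
- by apply: logder_mulr; apply: logder_scale; exact: logder_part_sum.
Qed.

(** Since [coefV k + coefU k] is 4^k times [coefU k], the product of the two exponentials is the
    exponential for U at 2x; in powers of x^2 this scales by 4^t. *)
Lemma psumVU (t : nat) :
  \sum_(i < t.+1) psumV i * psumU (t - i) = 4%:R ^+ t *: psumU t.
Proof.
apply: (@logder_inj (fun k => 4%:R ^+ k *: (k%:R *: (coefU k *: eisenstein k)))
  (fun t => \sum_(i < t.+1) psumV i * psumU (t - i)%N)
  (fun t => 4%:R ^+ t *: psumU t)).
- by rewrite scale0r scaler0.
- by rewrite big_ord1 expr0 scale1r /psumU /psumV !part_sum0 mul1r.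
- have -> : (fun k => 4%:R ^+ k *: (k%:R *: (coefU k *: eisenstein k))) =
    (fun k => k%:R *: (coefV k *: eisenstein k) + k%:R *: (coefU k *: eisenstein k)).
    apply/funext => k; rewrite coefV_eisenstein -scalerDr scalerA mulrC -scalerA.
    by rewrite scalerBl scale1r subrK.
  by apply: logderM; exact: logder_part_sum.
- by apply: logder_scale; exact: logder_part_sum.
Qed.

Definition egfV (t : nat) : fps rat := (2 * t)`!%:R^-1 *: thetaV (2 * t).

(** The coefficient of x^(2t+1) in the quintuple product identity: T has only odd moments, which
    leaves the even moments of the other factor. *)
Lemma egfV_egfU (t : nat) :
  \sum_(i < t.+1) egfV (t - i) * egfU i = 4%:R ^+ t *: (thetaV 0 * egfU t).
Proof.
have := @thetaVZ_odd (2 * t).+1; rewrite /= mul2n odd_double -mul2n => /(_ isT).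
have -> : thetaVZ (2 * t).+1 = \sum_(i < (2 * t).+2) 'C((2 * t).+1, i)%:R *:
    (thetaV ((2 * t).+1 - i) * thetaZ i).
  exact: (qseries_moment (fun n : int => (-1) ^ n) (fun n : int => (6 * n + 1)%:~R)
    (fun k : int => (-1) ^ k) (fun k : int => (2 * k + 1)%:~R) _ pent_fibers triz_fibers).
rewrite (_ : (2 * t).+2 = 2 * t.+1)%N; last by lia.
rewrite (sum_pairs (fun i => 'C((2 * t).+1, i)%:R *:
    (thetaV ((2 * t).+1 - i) * thetaZ i))) => H.
apply: (@scalerI rat (fps rat) ((2 * t).+1`!%:R * 2%:R)).
  by rewrite mulf_neq0 // natr_fact_neq0.
have -> : ((2 * t).+1`!%:R * 2%:R) *: (4%:R ^+ t *: (thetaV 0 * egfU t)) =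
   2%:R ^+ (2 * t).+1 *: (thetaV 0 * thetaU (2 * t).+1).
  rewrite /egfU -scalerAr !scalerA exprS exprM; congr (_ *: _).
  by field; exact: natr_fact_neq0.
rewrite -H scaler_sumr; apply: eq_bigr => i _.
have it : (i <= t)%N by rewrite -ltnS.
rewrite thetaZ_even ?mulr0 ?scaler0 ?add0r; last by lia.
rewrite thetaZ_odd; last by lia.
rewrite (_ : (2 * t).+1 - (2 * i).+1 = 2 * (t - i))%N; last by lia.
rewrite /egfV /egfU -scalerAl -!scalerAr !scalerA; congr (_ *: _).
have lt2 : ((2 * i).+1 <= (2 * t).+1)%N by lia.
rewrite -(bin_fact lt2) (_ : (2 * t).+1 - (2 * i).+1 = 2 * (t - i))%N; last by lia.
rewrite (natrM _ 'C(_, _)) (natrM _ (2 * i).+1`!).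
by field; rewrite !natr_fact_neq0.
Qed.

Lemma egfU0_unit : egfU 0 \is a GRing.unit.
Proof. by rewrite /egfU invr1 scale1r; exact: thetaU_unit. Qed.

(** Both sides have the same convolution with the coefficients 4^i [psumU i], whose constant term is
    1, so they agree by strong induction. *)
Lemma egfV_psum (t : nat) : egfV t = 4%:R ^+ t *: psumV t * thetaV 0.
Proof.
have convV n : \sum_(i < n.+1) egfV (n - i) * (4%:R ^+ i *: psumU i) =
    4%:R ^+ n *: (thetaV 0 * (4%:R ^+ n *: psumU n)).
  apply: (mulIr egfU0_unit); rewrite mulr_suml.
  under eq_bigr do rewrite -mulrA -egfU_psum.
  by rewrite egfV_egfU -scalerAl -mulrA -egfU_psum.
have convW n : \sum_(i < n.+1) (4%:R ^+ (n - i) *: psumV (n - i) * thetaV 0) *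
    (4%:R ^+ i *: psumU i) = 4%:R ^+ n *: (thetaV 0 * (4%:R ^+ n *: psumU n)).
  rewrite -psumVU (convC (fun i => psumV i) (fun i => psumU i)) mulr_sumr scaler_sumr.
  apply: eq_bigr => i _; have it : (i <= n)%N by rewrite -ltnS.
  rewrite -!scalerAl -!scalerAr scalerA -exprD subnK //; congr (_ *: _); ring.
elim/ltn_ind: t => t IH; have := convV t; rewrite -convW.
rewrite !big_ord_recl !subn0 expr0 scale1r /psumU part_sum0 !mulr1.
set S := \sum_(i < t) _; set S' := \sum_(i < t) _.
have -> : S = S'; last by move/addIr.
apply: eq_bigr => i _; rewrite IH // lift0; have := ltn_ord i; lia.
Qed.

Theorem theorem1p2 (t : nat) (ht : (0 < t)%N) :
  Useries (2 * t) = Tr t phiU /\ Vseries (2 * t) = Tr t phiV.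
Proof.
have E1 : thetaU 1 = egfU 0 by rewrite /egfU invr1 scale1r.
split.
  rewrite (@Tr_part_sum t (4%:R ^+ t * (2 * t).+1`!%:R) coefU); last first.
    by move=> l lt; rewrite /phiU lt.
  rewrite -/(psumU t) /Useries E1.
  have -> : thetaU (2 * t).+1 = (2 * t).+1`!%:R *: egfU t.
    by rewrite /egfU scalerA divff ?scale1r ?natr_fact_neq0.
  by rewrite egfU_psum scalerAl mulrK ?egfU0_unit // scalerA mulrC.
rewrite (@Tr_part_sum t (4%:R ^+ t * (2 * t)`!%:R) coefV); last first.
  by move=> l lt; rewrite /phiV lt.
rewrite -/(psumV t) /Vseries.
have -> : thetaV (2 * t) = (2 * t)`!%:R *: egfV t.
  by rewrite /egfV scalerA divff ?scale1r ?natr_fact_neq0.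
by rewrite egfV_psum scalerAl mulrK ?thetaV_unit // scalerA mulrC.
Qed.
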